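(* Let $\mathfrak P_{\mathrm{Boole}}$ be the poset of all $\equiv$-classes $\overline{\mathcal C}$ of clones $\mathcal C$ on $\{0,1\}$, ordered by $\overline{\mathcal C}\preceq\overline{\mathcal D}$ iff $\mathcal C\preceq\mathcal D$. Then $\mathfrak P_{\mathrm{Boole}}$ is the following lattice. Elements: the classes $$\overline{[\emptyset]},\ \overline{[\wedge]},\ \overline{[d_3]},\ \overline{[m]},\ \overline{[d_3,m]},\ \overline{[p]},\ \overline{[q]},\ \overline{[d_i,p]}\ (i\geq 3),\ \overline{[d_i,q]}\ (i\geq 3),\ \overline{[m,q]},\ \overline{[0]}$$ are pairwise distinct, and every clone on $\{0,1\}$ belongs to exactly one of them. Order: the order $\preceq$ on these elements is the reflexive and transitive closure of the following (strict) relations: (1) $\overline{[\emptyset]}\prec\overline{[\wedge]}$, $\overline{[\emptyset]}\prec\overline{[d_3]}$, $\overline{[\emptyset]}\prec\overline{[m]}$; (2) $\overline{[d_3]}\prec\overline{[d_3,m]}$, $\overline{[m]}\prec\overline{[d_3,m]}$; (3) $\overline{[\wedge]}\prec\overline{[p]}\prec\overline{[q]}$; (4) $\overline{[d_3]}\prec\overline{[d_3,p]}$; (5) $\overline{[p]}\prec\overline{[d_{i+1},p]}\prec\overline{[d_i,p]}$ for every $i\geq 3$; (6) $\overline{[q]}\prec\overline{[d_{i+1},q]}\prec\overline{[d_i,q]}$ for every $i\geq 3$; (7) $\overline{[d_i,p]}\prec\overline{[d_i,q]}$ for every $i\geq 3$; (8) $\overline{[d_3,m]}\prec\overline{[m,q]}$,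 $\overline{[d_3,q]}\prec\overline{[m,q]}$; (9) $\overline{[m,q]}\prec\overline{[0]}$.
   Context: An operation on a set $A$ is a map $A^n\to A$ with $n\geq 1$. A clone on $A$ is a set of operations on $A$ that contains all projections and is closed under composition. For operations $f_1,\dots,f_n$ on $\{0,1\}$, $[f_1,\dots,f_n]$ denotes the clone on $\{0,1\}$ generated by them; $[\emptyset]$ is the clone of all projections. For an $n$-ary operation $f$ and a map $\pi\colon\{1,\dots,n\}\to\{1,\dots,r\}$ let $f_\pi(x_1,\dots,x_r):=f(x_{\pi(1)},\dots,x_{\pi(n)})$. A map $\xi\colon\mathcal A\to\mathcal B$ between clones is minor-preserving if it preserves arities and $\xi(f_\pi)=\xi(f)_\pi$ for all $n$-ary $f\in\mathcal A$ and all $\pi\colon\{1,\dots,n\}\to\{1,\dots,r\}$. Write $\mathcal A\preceq\mathcal B$ if there is a minor-preserving map $\mathcal A\to\mathcal B$, and $\mathcal A\equiv\mathcal B$ if $\mathcal A\preceq\mathcal B$ and $\mathcal B\preceq\mathcal A$. $\overline{\mathcal A}$ is the $\equiv$-class of $\mathcal A$; $\prec$ means $\preceq$ but not equal (as classes). Operations on $\{0,1\}$: $0$ is the unary constant operation with value $0$; $\wedge,\vee$ are the usual Boolean conjunction and disjunction; $d_n(x_1,\dots,x_n):=\bigvee_{i=1}^n\bigwedge_{j\neq i}x_j$ (so $d_3$ is the majority operation); $m(x,y,z):=x+y+z \bmod 2$; $p(x,y,z):=x\wedge(y\vee z)$; $q(x,y,z):=x\wedge(y\oplus' z)$ where $y\oplus'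 z=1$ iff $y=z$. *)

(* Defs.v *)
From HB Require Import structures.
From mathcomp Require Import all_boot all_order.
From mathcomp Require Import boolp classical_sets.
From Stdlib Require Export Relation_Operators.

Set Implicit Arguments.
Unset Strict Implicit.
Unset Printing Implicit Defensive.

Import Order.TTheory.

(* [op 0] is not excluded here: positivity of arities is a field of [clone]. *)
Definition op (n : nat) := {ffun {ffun 'I_n -> bool} -> bool}.

Definition proj n (i : 'I_n) : op n := [ffun x : {ffun 'I_n -> bool} => x i].

Definition comp n k (f : op n) (g : 'I_n -> op k) : op k :=
  [ffun x : {ffun 'I_k -> bool} => f [ffun i => g i x]].

Definition minor n r (f : op n) (s : 'I_n -> 'I_r) : op r :=
  [ffun x : {ffun 'I_r -> bool} => f [ffun i => x (s i)]].

Record clone := Clone {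
  mem_clone :> forall n, op n -> Prop;
  clone_arity : forall n (f : op n), mem_clone f -> 0 < n;
  clone_proj : forall n (i : 'I_n), mem_clone (proj i);
  clone_comp : forall n k (f : op n) (g : 'I_n -> op k),
    mem_clone f -> (forall i, mem_clone (g i)) -> mem_clone (comp f g) }.

Inductive generated (F : seq {n & op n}) : forall n, op n -> Prop :=
| gen_base n (f : op n) : 0 < n -> Tagged op f \in F -> generated F f
| gen_proj n (i : 'I_n) : generated F (proj i)
| gen_comp n k (f : op n) (g : 'I_n -> op k) :
    generated F f -> (forall i, generated F (g i)) -> generated F (comp f g).

Lemma generated_arity F n (f : op n) : generated F f -> 0 < n.
Proof.
elim=> {n f} // [n [i lt_i_n] | n k f g _ n_gt0 _ k_gt0].
- exact: leq_ltn_trans lt_i_n.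
- exact: k_gt0 (Ordinal n_gt0).
Qed.

Definition clone_gen (F : seq {n & op n}) : clone :=
  Clone (@generated_arity F) (@gen_proj F) (@gen_comp F).

(* A map A -> B is given by a family of total maps on operations, whose values
   outside A are irrelevant; [minor f s] is in A as soon as f is. *)
Definition minor_preserving (A B : clone) (xi : forall n, op n -> op n) : Prop :=
  (forall n (f : op n), A n f -> B n (xi n f)) /\
  (forall n r (f : op n) (s : 'I_n -> 'I_r),
     A n f -> xi r (minor f s) = minor (xi n f) s).

Definition minor_le (A B : clone) : Prop := exists xi, minor_preserving A B xi.

Lemma clone_minor (A : clone) n r (f : op n) (s : 'I_n -> 'I_r) :
  A n f -> A r (minor f s).
Proof.
move=> Af; have -> : minor f s = comp f (fun i => proj (s i)).
  by apply/ffunP => x; rewrite !ffunE; congr (f _); apply/ffunP => i; rewrite !ffunE.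
by apply: clone_comp => // i; apply: clone_proj.
Qed.

Lemma minor_le_refl A : minor_le A A.
Proof. by exists (fun n f => f). Qed.

Lemma minor_le_trans B A C : minor_le A B -> minor_le B C -> minor_le A C.
Proof.
move=> [xi [xiB xiM]] [ze [zeC zeM]]; exists (fun n f => ze n (xi n f)).
split=> [n f Af | n r f s Af]; first exact/zeC/xiB.
by rewrite xiM // zeM //; apply: xiB.
Qed.

Definition minor_equiv (A B : clone) : bool := `[< minor_le A B /\ minor_le B A >].

Lemma minor_equiv_refl : reflexive minor_equiv.
Proof. by move=> A; apply/asboolP; split; apply: minor_le_refl. Qed.

Lemma minor_equiv_sym : symmetric minor_equiv.
Proof. by move=> A B; apply/asboolP/asboolP => -[]. Qed.

Lemma minor_equiv_trans : transitive minor_equiv.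
Proof.
move=> B A C /asboolP[AB BA] /asboolP[BC CB]; apply/asboolP.
by split; apply: (@minor_le_trans B).
Qed.

HB.instance Definition _ := gen_eqMixin clone.
HB.instance Definition _ := gen_choiceMixin clone.

Canonical minor_equiv_rel :=
  EquivRel minor_equiv minor_equiv_refl minor_equiv_sym minor_equiv_trans.

Definition PBoole := {eq_quot minor_equiv}%qT.
HB.instance Definition _ := Choice.on PBoole.

Definition cls (A : clone) : PBoole := (\pi_({eq_quot minor_equiv}) A)%qT.

Lemma cls_eqP A B : cls A = cls B <-> minor_le A B /\ minor_le B A.
Proof. by split=> [/eqmodP/asboolP | AB]; [|apply/eqmodP/asboolP]. Qed.

(* The order on classes, through representatives; [le_clsP] below shows that it
   does not depend on their choice. *)
Definition le_PBoole (X Y : PBoole) : bool := `[< minor_le (repr X) (repr Y) >].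

Lemma cls_repr X : cls (repr X) = X.
Proof. exact: reprK. Qed.

Lemma le_PBoole_refl : reflexive le_PBoole.
Proof. by move=> X; apply/asboolP/minor_le_refl. Qed.

Lemma le_PBoole_anti : antisymmetric le_PBoole.
Proof.
move=> X Y /andP[/asboolP XY /asboolP YX].
by rewrite -(cls_repr X) -(cls_repr Y); apply/cls_eqP.
Qed.

Lemma le_PBoole_trans : transitive le_PBoole.
Proof.
by move=> Y X Z /asboolP XY /asboolP YZ; apply/asboolP/(minor_le_trans XY).
Qed.

Fact PBoole_display : Order.disp_t. Proof. exact: Order.Disp tt tt. Qed.

HB.instance Definition _ := Order.Le_isPOrder.Build PBoole_display PBoole
  le_PBoole_refl le_PBoole_anti le_PBoole_trans.

Lemma le_clsP A B : reflect (minor_le A B) (cls A <= cls B)%O.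
Proof.
have /cls_eqP[A1 A2] := cls_repr (cls A); have /cls_eqP[B1 B2] := cls_repr (cls B).
apply: (iffP (asboolP _)) => AB.
- exact: minor_le_trans (minor_le_trans A2 AB) B1.
- exact: minor_le_trans (minor_le_trans A1 AB) B2.
Qed.

Definition op1 (f : bool -> bool) : op 1 :=
  [ffun x : {ffun 'I_1 -> bool} => f (x (@Ordinal 1 0 isT))].
Definition op2 (f : bool -> bool -> bool) : op 2 :=
  [ffun x : {ffun 'I_2 -> bool} => f (x (@Ordinal 2 0 isT)) (x (@Ordinal 2 1 isT))].
Definition op3 (f : bool -> bool -> bool -> bool) : op 3 :=
  [ffun x : {ffun 'I_3 -> bool} =>
     f (x (@Ordinal 3 0 isT)) (x (@Ordinal 3 1 isT)) (x (@Ordinal 3 2 isT))].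

Definition zero_op : op 1 := op1 (fun=> false).
Definition and_op : op 2 := op2 andb.
Definition d_op (n : nat) : op n :=
  [ffun x : {ffun 'I_n -> bool} => [exists i, [forall (j | j != i), x j]]].
Definition m_op : op 3 := op3 (fun x y z => x (+) y (+) z).
Definition p_op : op 3 := op3 (fun x y z => x && (y || z)).
Definition q_op : op 3 := op3 (fun x y z => x && (y == z)).

Inductive node :=
| N_empty | N_and | N_d3 | N_m | N_d3m | N_p | N_q
| N_dp (i : nat) of 3 <= i
| N_dq (i : nat) of 3 <= i
| N_mq | N_0.

Definition node_gens (e : node) : seq {n & op n} :=
  match e with
  | N_empty => [::]
  | N_and => [:: Tagged op and_op]
  | N_d3 => [:: Tagged op (d_op 3)]
  | N_m => [:: Tagged op m_op]
  | N_d3m => [:: Tagged op (d_op 3); Tagged op m_op]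
  | N_p => [:: Tagged op p_op]
  | N_q => [:: Tagged op q_op]
  | @N_dp i _ => [:: Tagged op (d_op i); Tagged op p_op]
  | @N_dq i _ => [:: Tagged op (d_op i); Tagged op q_op]
  | N_mq => [:: Tagged op m_op; Tagged op q_op]
  | N_0 => [:: Tagged op zero_op]
  end.

Definition node_cls (e : node) : PBoole := cls (clone_gen (node_gens e)).

Inductive node_cover : node -> node -> Prop :=
| cover_empty_and : node_cover N_empty N_and
| cover_empty_d3 : node_cover N_empty N_d3
| cover_empty_m : node_cover N_empty N_m
| cover_d3_d3m : node_cover N_d3 N_d3m
| cover_m_d3m : node_cover N_m N_d3m
| cover_and_p : node_cover N_and N_p
| cover_p_q : node_cover N_p N_q
| cover_d3_d3p (h : 3 <= 3) : node_cover N_d3 (N_dp h)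
| cover_p_dp i (h : 3 <= i.+1) : 3 <= i -> node_cover N_p (N_dp h)
| cover_dp_dp i (h' : 3 <= i.+1) (h : 3 <= i) : node_cover (N_dp h') (N_dp h)
| cover_q_dq i (h : 3 <= i.+1) : 3 <= i -> node_cover N_q (N_dq h)
| cover_dq_dq i (h' : 3 <= i.+1) (h : 3 <= i) : node_cover (N_dq h') (N_dq h)
| cover_dp_dq i (h h' : 3 <= i) : node_cover (N_dp h) (N_dq h')
| cover_d3m_mq : node_cover N_d3m N_mq
| cover_d3q_mq (h : 3 <= 3) : node_cover (N_dq h) N_mq
| cover_mq_0 : node_cover N_mq N_0.

(* Main.v *)
(** A clone containing a constant operation is a largest element. Otherwise the
    diagonal of every operation is the identity or the negation, composing with it
    reduces to idempotent clones, and by duality an idempotent clone that contains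
    [or_op] may be assumed to contain [and_op].

    An idempotent clone with neither [and_op] nor [or_op] is self-dual, and its
    ternary minors decide among [N_empty], [N_d3], [N_m] and [N_d3m]. Let the clone
    contain [and_op] but not [or_op]. It consists of meets of variables unless it
    contains [p_op], it is monotone unless it contains [q_op], and any two true points
    of an operation share a coordinate equal to 1. If [k] is largest such that any [k]
    true points share one, a failure for [k + 1] yields [d_op k.+1]; by Baker-Pixley
    interpolation this pins down the clone. If there is no such [k], every operation
    lies below a projection. The monotone clone with both [and_op] and [or_op]
    is equivalent to [N_dp 3] through the map sending [f] to the meet of [f] and its
    dual. Non-comparabilities come from identities between binary minors. *)
Require Import Defs.
From mathcomp Require Import all_boot all_order.
From mathcomp Require Import boolp classical_sets.

Set Implicit Arguments.
Unset Strict Implicit.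
Unset Printing Implicit Defensive.

Import Order.TTheory.

(** * Boolean vectors, terms of a clone, and interpolation *)

Notation bvec n := {ffun 'I_n -> bool}.

Definition cst n (b : bool) : bvec n := [ffun=> b].
Definition neg n (x : bvec n) : bvec n := [ffun i => ~~ x i].
Definition meet n (x y : bvec n) : bvec n := [ffun i => x i && y i].
Definition unit_bvec n (i : 'I_n) : bvec n := [ffun j => j == i].

Lemma negK n : involutive (@neg n).
Proof. by move=> x; apply/ffunP=> i; rewrite !ffunE negbK. Qed.

Lemma cst_or_false n (x : bvec n) : x = cst n true \/ exists i, x i = false.
Proof.
case: (pickP (fun i => ~~ x i)) => [i /negbTE xi | x1]; first by right; exists i.
by left; apply/ffunP=> i; rewrite ffunE; apply/negbNE; rewrite x1.
Qed.

Lemma cst_or_true n (x : bvec n) : x = cst n false \/ exists i, x i.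
Proof.
case: (cst_or_false (neg x)) => [x0 | [i]]; last first.
  by rewrite ffunE => /negbFE; right; exists i.
by left; rewrite -[x]negK x0; apply/ffunP=> i; rewrite !ffunE.
Qed.

Lemma ord2_all (P : 'I_2 -> Prop) :
  P (@Ordinal 2 0 isT) -> P (@Ordinal 2 1 isT) -> forall i, P i.
Proof.
move=> P0 P1 [[|[|//]] lt_i].
- by rewrite (bool_irrelevance lt_i isT).
- by rewrite (bool_irrelevance lt_i isT).
Qed.

Lemma ord3_all (P : 'I_3 -> Prop) : P (@Ordinal 3 0 isT) -> P (@Ordinal 3 1 isT) ->
  P (@Ordinal 3 2 isT) -> forall i, P i.
Proof.
move=> P0 P1 P2 [[|[|[|//]]] lt_i].
- by rewrite (bool_irrelevance lt_i isT).
- by rewrite (bool_irrelevance lt_i isT).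
- by rewrite (bool_irrelevance lt_i isT).
Qed.

Definition pick2 T (a b : T) (i : 'I_2) : T := if val i is 0 then a else b.
Definition pick3 T (a b c : T) (i : 'I_3) : T :=
  match val i with 0 => a | 1 => b | _ => c end.

(** Membership for plain functions, so that composites can be written as ordinary Boolean
    expressions and compared pointwise. *)
Definition term (C : clone) n (F : bvec n -> bool) : Prop := C n [ffun x => F x].

Section Terms.
Variable C : clone.

Lemma term_ext n (F G : bvec n -> bool) : term C F -> F =1 G -> term C G.
Proof. by move=> CF FG; have <- : F = G by apply: funext. Qed.

Lemma term_memE n (f : op n) : term C f = C n f.
Proof. by rewrite /term; congr (C _ _); apply/ffunP=> x; rewrite ffunE. Qed.

Lemma mem_term n (f : op n) (F : bvec n -> bool) : term C F -> F =1 f -> C n f.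
Proof. by move=> CF Ff; rewrite -term_memE; apply: term_ext Ff. Qed.

Lemma term_proj n (i : 'I_n) : term C (fun x => x i).
Proof. exact: clone_proj. Qed.

Lemma term_app n k (f : op n) (G : 'I_n -> bvec k -> bool) :
  C n f -> (forall i, term C (G i)) -> term C (fun z => f [ffun i => G i z]).
Proof.
move=> Cf CG; rewrite /term.
have <- : Defs.comp f (fun i => [ffun x => G i x]) = [ffun x => f [ffun i => G i x]].
  by apply/ffunP=> x; rewrite !ffunE; congr (f _); apply/ffunP=> i; rewrite !ffunE.
by apply: clone_comp => // i; apply: CG.
Qed.

Lemma term2 t k (F G : bvec k -> bool) :
  C 2 (op2 t) -> term C F -> term C G -> term C (fun x => t (F x) (G x)).
Proof.
move=> Ct CF CG; have CFG i : term C (pick2 F G i) by move: i; apply: ord2_all.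
by apply: term_ext (term_app Ct CFG) _ => x; rewrite !ffunE.
Qed.

Lemma term3 t k (F G H : bvec k -> bool) : C 3 (op3 t) ->
  term C F -> term C G -> term C H -> term C (fun x => t (F x) (G x) (H x)).
Proof.
move=> Ct CF CG CH.
have CFGH i : term C (pick3 F G H i) by move: i; apply: ord3_all.
by apply: term_ext (term_app Ct CFGH) _ => x; rewrite !ffunE.
Qed.

Lemma mem_op2 t : (forall k (F G : bvec k -> bool),
  term C F -> term C G -> term C (fun x => t (F x) (G x))) -> C 2 (op2 t).
Proof. by move=> Ct; apply: Ct; apply: term_proj. Qed.

Lemma mem_op3 t : (forall k (F G H : bvec k -> bool), term C F -> term C G ->
  term C H -> term C (fun x => t (F x) (G x) (H x))) -> C 3 (op3 t).
Proof. by move=> Ct; apply: Ct; apply: term_proj. Qed.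

End Terms.

Definition or_op : op 2 := op2 orb.
Definition maj (x y z : bool) := x && y || x && z || y && z.
(** Interdefinable with [q_op] once meets are available, and easier to build terms with. *)
Definition h_op : op 3 := op3 (fun x y z => x && (y ==> z)).

Lemma d3E : d_op 3 = op3 maj.
Proof.
apply/ffunP=> x; rewrite !ffunE /maj.
set a := x _; set b := x _; set c := x _.
have all3 (P : pred 'I_3) : (forall j, P j) <-> [/\ P (@Ordinal 3 0 isT),
    P (@Ordinal 3 1 isT) & P (@Ordinal 3 2 isT)].
  by split=> // -[P0 P1 P2]; apply: ord3_all.
apply/existsP/idP => [[i /forallP] | abc].
  by move: i; apply: ord3_all => /all3[] /=; rewrite -/a -/b -/c; case: a b c => [] [] [].
move: abc; case Ea: a; case Eb: b; case Ec: c => //= _;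
  [exists (@Ordinal 3 0 isT) | exists (@Ordinal 3 2 isT) |
   exists (@Ordinal 3 1 isT) | exists (@Ordinal 3 0 isT)];
  by apply/forallP/all3; rewrite /= -?/a -?/b -?/c ?Ea ?Eb ?Ec.
Qed.

Section Meets.
Variable C : clone.
Hypothesis C_and : C 2 and_op.

Lemma term_and k (F G : bvec k -> bool) :
  term C F -> term C G -> term C (fun x => F x && G x).
Proof. exact: (term2 C_and). Qed.

(** The index set must be nonempty: an empty meet is the constant true, which an idempotent clone
    lacks. *)
Lemma term_forall k (T : finType) (A : pred T) (G : T -> bvec k -> bool) :
  (exists t, A t) -> (forall t, A t -> term C (G t)) ->
  term C (fun x => [forall (t | A t), G t x]).
Proof.
move=> [t0 At0] CG.
suff CA : term C (fun x => all (G^~ x) (enum A)).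
  by apply: term_ext CA _ => x; apply/allP/forall_inP => AG t; have := AG t; rewrite mem_enum.
have : forall t, t \in enum A -> term C (G t).
  by move=> t; rewrite mem_enum => /CG.
have : enum A != [::] by apply/eqP=> A0; have := mem_enum A t0; rewrite A0 inE [RHS]At0.
elim: (enum A) => // t [|u s] IHs _ CGs.
  by apply: term_ext (CGs t _) _ => [|x] /=; rewrite ?andbT // mem_head.
apply: term_ext (term_and (CGs t _) (IHs _ _)) _ => //; first exact: mem_head.
by move=> v sv; apply: CGs; rewrite inE sv orbT.
Qed.

(** [f] is the meet of all members of [C] above it, since each false point of [f] is cut out by one
    of them. The false value at the zero vector provides at least one such member. *)
Lemma meet_interpolation n (f : op n) : f (cst n false) = false ->
  (forall y, f y = false -> exists g, [/\ C n g, g y = false & forall x, f x -> g x]) ->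
  C n f.
Proof.
move=> f0 sep; pose A := [pred g : op n | `[< C n g >] && [forall x, f x ==> g x]].
have AP g : reflect (C n g /\ forall x, f x -> g x) (A g).
  apply: (iffP andP) => -[Cg fg]; split; try exact/asboolP.
    by move=> x; apply/implyP; move: x; apply/forallP.
  by apply/forallP=> x; apply/implyP/fg.
suff CA : term C (fun x => [forall (g : op n | A g), g x]).
  apply: mem_term CA _ => x; apply/forall_inP/idP => [Ax | fx g /AP[_]]; last exact.
  apply/negPn/negP=> /negbTE fx; have [g [Cg gx fg]] := sep x fx.
  by have := Ax g; rewrite gx; have /AP -> : C n g /\ forall x, f x -> g x by []; move/(_ isT).
apply: term_forall => [|g /AP[Cg _]]; last by rewrite term_memE.
by have [g [Cg _ fg]] := sep _ f0; exists g; apply/AP.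
Qed.

End Meets.

Lemma ord_avoid n (a b : 'I_n) : 3 <= n -> exists c, (c != a) && (c != b).
Proof.
move=> n3; case: (pickP (fun c => (c != a) && (c != b))) => [c abc | ab]; first by exists c.
have : #|[set: 'I_n]| <= #|[set a; b]|.
  apply/subset_leq_card/fintype.subsetP=> c _; rewrite !inE.
  by move/negbT: (ab c); rewrite negb_and !negbK.
rewrite cardsT card_ord => /(leq_trans n3); rewrite cards2.
by case: (a != b).
Qed.

Lemma d_opP n (x : bvec n) :
  reflect (exists i, forall j, j != i -> x j) (d_op n x).
Proof.
by rewrite ffunE; apply: (iffP existsP) => -[i] => [/forall_inP|] ?; exists i => //;
  apply/forall_inP.
Qed.

(* The Baker-Pixley theorem for the near-unanimity operation [d_op n]. *)
Lemma nu_interpolation (C : clone) n k (f : op k) : 3 <= n -> C n (d_op n) ->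
  (forall X : 'I_n.-1 -> bvec k, exists2 g, C k g & forall j, g (X j) = f (X j)) ->
  C k f.
Proof.
move=> n3 Cd loc.
suff /(_ [set: bvec k])[g Cg gf] : forall S : {set bvec k},
    exists2 g, C k g & {in S, g =1 f}.
  by have <- : g = f by apply/ffunP=> x; apply: gf; rewrite inE.
move=> S; have [m] := ubnP #|S|; elim: m S => // m IHm S; rewrite ltnS => Sm.
(* When [S] has fewer than [n.-1] points, the default value pads the family to the length that [loc]
   asks for. *)
pose X (i : nat) := nth (cst k true) (enum S) i.
have [Sn | Sn] := ltnP #|S| n.
  have [g Cg gf] := loc (fun i => X i); exists g => // x Sx.
  have xS : x \in enum S by rewrite mem_enum.
  have lt_x : index x (enum S) < n.-1.
    by rewrite (@leq_trans #|S|) // ?cardE ?index_mem // -ltnS -cardE prednK // (leq_trans _ n3).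
  by have := gf (Ordinal lt_x); rewrite /X /= nth_index.
have XS (i : 'I_n) : X i \in S.
  by rewrite -mem_enum mem_nth // -cardE (leq_trans (ltn_ord i)).
have X_inj (i j : 'I_n) : X i = X j -> i = j.
  move/eqP; rewrite nth_uniq ?enum_uniq // -?cardE ?(leq_trans (ltn_ord _)) //.
  by move/eqP/val_inj.
(* Each [g i] agrees with [f] on [S] except perhaps at [X i]. These points are distinct, so at any
   [x] in [S] at most one [g i] is wrong, and [d_op n] overrules it. *)
have /fin_all_exists[g gP] (i : 'I_n) :
    exists g, C k g /\ {in S :\ X i, g =1 f}.
  have [|g Cg gf] := IHm (S :\ X i); last by exists g.
  by rewrite (cardsD1 (X i)) XS in Sm.
exists (Defs.comp (d_op n) g) => [|x Sx].
  by apply: clone_comp => // i; case: (gP i).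
have gx (i : 'I_n) : x != X i -> g i x = f x.
  by move=> xi; case: (gP i) => _ ->; rewrite // !inE xi.
have [i0 gi0] : exists i0 : 'I_n, forall j, j != i0 -> g j x = f x.
  case: (pickP (fun i : 'I_n => x == X i)) => [i /eqP xi | nX].
    exists i => j; apply: contraNeq => gj; have [/X_inj//->//|xj] := eqVneq (X i) (X j).
    by rewrite gx ?eqxx // xi in gj.
  by exists (Ordinal (leq_trans (isT : 0 < 3) n3)) => j _; rewrite gx ?nX.
rewrite ffunE; apply/d_opP/idP => [[i gi] | fx].
  (* As [n >= 3], some index avoids both exceptions; there the value is both true and [f x]. *)
  have [c /andP[ci ci0]] := ord_avoid i i0 n3.
  by have := gi c ci; rewrite ffunE gi0.
by exists i0 => j /gi0 ji0; rewrite ffunE ji0.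
Qed.

(** * Properties of operations and generation *)

Definition le_bvec n (x y : bvec n) := forall i, x i -> y i.
Definition idem n (f : op n) := f (cst n false) = false /\ f (cst n true) = true.
Definition mono n (f : op n) := forall x y, le_bvec x y -> f x -> f y.
Definition selfdual n (f : op n) := forall x, f (neg x) = ~~ f x.
Definition add3 n (x y z : bvec n) : bvec n := [ffun i => x i (+) y i (+) z i].
Definition affine n (f : op n) :=
  forall x y z, f (add3 x y z) = f x (+) f y (+) f z.
(** Additivity restricted to disjoint supports is what a ternary minor of [f] can test. *)
Definition add_disjoint n (f : op n) := forall x y : bvec n,
  (forall i, ~~ (x i && y i)) -> f [ffun i => x i (+) y i] = f x (+) f y.
Definition meet_morph n (f : op n) := forall x y, f (meet x y) = f x && f y.
(** Equivalently, [f] preserves the [k]-ary relation of all tuples but the all-true one; hence its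
    stability under composition. *)
Definition k_meeting k n (f : op n) := forall X : 'I_k -> bvec n,
  (forall j, f (X j)) -> exists i, forall j, X j i.
Definition below_proj n (f : op n) := exists i, forall x : bvec n, f x -> x i.

Lemma idem_arity n (f : op n) : idem f -> 0 < n.
Proof.
case: n f => // f [f0 f1]; suff E : cst 0 false = cst 0 true by rewrite E f1 in f0.
by apply/ffunP=> -[].
Qed.

Lemma idem_not_cst n (f : op n) (x : bvec n) : idem f -> f x = false -> exists i, x i = false.
Proof. by move=> [_ f1] fx; case: (cst_or_false x) => // x1; rewrite x1 f1 in fx. Qed.

Lemma idem_cst n (f : op n) b : idem f -> f (cst n b) = b.
Proof. by case: b => -[]. Qed.

(** If [x] and [y] were disjoint, [x] would lie below [neg y]. *)
Lemma mono_meeting n (f : op n) (x y : bvec n) :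
  mono f -> f x -> f (neg y) = false -> exists i, x i && y i.
Proof.
move=> fm fx fy; case: (pickP (fun i => x i && y i)) => [i xyi|nxy]; first by exists i.
rewrite (fm x) // in fy => i xi; rewrite ffunE.
by have := nxy i; rewrite xi => /= ->.
Qed.

Lemma mono_selfdual_meeting n (f : op n) (x y : bvec n) :
  mono f -> selfdual f -> f x -> f y -> exists i, x i && y i.
Proof. by move=> fm fs fx fy; apply: mono_meeting fm fx _; rewrite fs fy. Qed.

(** Replace the false points of the family by one of its true points; if there is none, any
    coordinate will do. *)
Lemma k_meeting_common k n (f : op n) (X : 'I_k -> bvec n) :
  idem f -> k_meeting k f -> exists i, forall j, f (X j) -> X j i.
Proof.
move=> fi fk; case: (pickP (fun j => f (X j))) => [j0 fj0 | fX]; last first.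
  by exists (Ordinal (idem_arity fi)) => j; rewrite fX.
have [j|i Xi] := fk (fun j => if f (X j) then X j else X j0).
  by case: ifP => // ->.
by exists i => j fj; have := Xi j; rewrite fj.
Qed.

Lemma k_meeting_le j k n (f : op n) : idem f -> j <= k -> k_meeting k f -> k_meeting j f.
Proof.
move=> fi jk fk X fX; case: j => [|j] in jk X fX *.
  by exists (Ordinal (idem_arity fi)) => -[].
(* [inord] sends the indices past the end to the first one, so the family is padded by
   repetition. *)
have [i Xi] := fk (fun l => X (inord l)) (fun l => fX _); exists i => l.
by have := Xi (widen_ord jk l); rewrite /= inord_val.
Qed.

Lemma below_proj_meeting k n (f : op n) : below_proj f -> k_meeting k f.
Proof. by move=> [i fx] X fX; exists i => j; apply/fx/fX. Qed.

(** If [f] is below no projection, choose for each coordinate a true point vanishing there: these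
    [n] points share no coordinate. *)
Lemma meeting_below_proj n (f : op n) : k_meeting n f -> below_proj f.
Proof.
move=> fn; apply: contrapT => nf.
have /fin_all_exists[X XP] (i : 'I_n) : exists x, f x && ~~ x i.
  by apply: contrapT => nx; apply: nf; exists i => x fx; apply: contrapT => /negP xi;
    apply: nx; exists x; rewrite fx.
have [i /(_ i)] := fn X (fun i => proj1 (andP (XP i))).
by apply/negP; case/andP: (XP i).
Qed.

Section Generation.
Variable C : clone.

Lemma and_of_p : C 3 p_op -> C 2 and_op.
Proof.
move=> Cp; apply: mem_op2 => k F G CF CG.
by apply: term_ext (term3 Cp CF CG CG) _ => x; rewrite orbb.
Qed.

Lemma and_of_q : C 3 q_op -> C 2 and_op.
Proof.
move=> Cq; apply: mem_op2 => k F G CF CG.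
by apply: term_ext (term3 Cq CF CF CG) _ => x; case: (F x) (G x) => [] [].
Qed.

Lemma h_of_q : C 3 q_op -> C 3 h_op.
Proof.
move=> Cq; apply: mem_op3 => k F G H CF CG CH.
apply: term_ext (term3 Cq CF (term_and (and_of_q Cq) CG CH) CG) _ => x.
by case: (F x) (G x) (H x) => [] [] [].
Qed.

Lemma p_of_q : C 3 q_op -> C 3 p_op.
Proof.
move=> /h_of_q Ch; apply: mem_op3 => k F G H CF CG CH.
apply: term_ext (term3 Ch CF (term3 Ch CF CG CH) CH) _ => x.
by case: (F x) (G x) (H x) => [] [] [].
Qed.

Lemma term_and_exists n (i : 'I_n) (A : pred 'I_n) : C 3 p_op ->
  (exists j, A j) -> term C (fun x => x i && [exists (j | A j), x j]).
Proof.
move=> Cp [j0 Aj0]; have Ci := term_proj C i.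
suff CA : term C (fun x => x i && has x (enum A)).
  apply: term_ext CA _ => x; congr (_ && _).
  by apply/hasP/exists_inP => -[j Aj xj]; exists j; rewrite ?mem_enum // in Aj *.
have : enum A != [::] by apply/eqP=> A0; have := mem_enum A j0; rewrite A0 inE [RHS]Aj0.
elim: (enum A) => // j [|l s] IHs _.
  apply: term_ext (term_and (and_of_p Cp) Ci (term_proj C j)) _ => x /=.
  by rewrite orbF.
apply: term_ext (term3 Cp Ci (term_proj C j) (IHs _)) _ => // x /=.
by case: (x i) => //=; rewrite orFb.
Qed.

(** Meet interpolation. A false point [y] with [y i] true is cut out by [x i] met with the join of
    the [x j] over the zeros [j] of [y]; a true point of [f] violating this would lie below [y]. *)
Lemma p_generates n (f : op n) : C 3 p_op -> idem f -> mono f -> below_proj f -> C n f.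
Proof.
move=> Cp fi fm [i fx_i]; apply: (meet_interpolation (and_of_p Cp)) => [|y fy].
  exact: (proj1 fi).
case Ey: (y i); last first.
  by exists (proj i); split; [apply: clone_proj | rewrite ffunE | move=> x /fx_i; rewrite ffunE].
have [j0 yj0] := idem_not_cst fi fy.
exists [ffun x : bvec n => x i && [exists (j | ~~ y j), x j]]; split.
- by apply: (term_and_exists _ Cp); exists j0; rewrite yj0.
- by rewrite ffunE Ey; apply/exists_inP=> -[j /negP yj /yj].
move=> x fx; rewrite ffunE fx_i //=; apply: contraFT fy => /exists_inPn xy.
by apply: fm fx => j xj; apply: contraLR xj => /xy.
Qed.

(** As for [p_op], but without monotonicity the separating term must exclude [y] alone: where [x i]
    holds, the implication fails exactly at [x = y]. *)
Lemma q_generates n (f : op n) : C 3 q_op -> idem f -> below_proj f -> C n f.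
Proof.
move=> Cq fi [i fx_i]; have C_and := and_of_q Cq.
apply: (meet_interpolation C_and) => [|y fy]; first exact: (proj1 fi).
case Ey: (y i); last first.
  by exists (proj i); split; [apply: clone_proj | rewrite ffunE | move=> x /fx_i; rewrite ffunE].
have [j0 yj0] := idem_not_cst fi fy.
exists [ffun x : bvec n =>
  x i && ([forall (j | y j), x j] ==> (x i && [exists (j | ~~ y j), x j]))]; split.
- apply: (term3 (h_of_q Cq) (term_proj C i)).
  + by apply: (term_forall C_and) => [|j _]; [exists i | apply: term_proj].
  + by apply: term_and_exists (p_of_q Cq) _; exists j0; rewrite yj0.
- rewrite ffunE Ey /=; have -> : [forall (j | y j), y j] by apply/forall_inP.
  by apply/exists_inP=> -[j /negP yj /yj].
move=> x fx; rewrite ffunE fx_i //=; apply/implyP => /forall_inP yx.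
apply: contraFT fy => /exists_inPn xy; suff -> : y = x by [].
apply/ffunP=> j; case Ej: (y j); first by rewrite yx.
exact/esym/negbTE/xy/negbT.
Qed.

(* Near a set of [i.-1] points, [f] coincides with its meet with a projection. *)
Lemma d_generates (P : forall n, op n -> Prop) i n (f : op n) :
  (forall j, P n f -> P n [ffun x : bvec n => x j && f x]) ->
  (forall g : op n, idem g -> P n g -> below_proj g -> C n g) ->
  3 <= i -> C i (d_op i) -> idem f -> P n f -> k_meeting i.-1 f -> C n f.
Proof.
move=> PI gen i3 Cd fi Pf fk; apply: (nu_interpolation i3 Cd) => X.
have [j fXj] := k_meeting_common X fi fk.
exists [ffun x : bvec n => x j && f x]; last first.
  by move=> l; rewrite ffunE; apply/andb_idl/fXj.
apply: gen; [|exact: PI|by exists j => x; rewrite ffunE => /andP[]].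
by case: fi => f0 f1; split; rewrite !ffunE ?f0 ?f1 ?andbF.
Qed.

Lemma dp_generates i n (f : op n) : 3 <= i -> C i (d_op i) -> C 3 p_op ->
  idem f -> mono f -> k_meeting i.-1 f -> C n f.
Proof.
move=> i3 Cd Cp; apply: d_generates i3 Cd => [j fm x y xy|g].
  by rewrite !ffunE => /andP[/xy -> /(fm _ _ xy)].
exact: p_generates.
Qed.

Lemma dq_generates i n (f : op n) : 3 <= i -> C i (d_op i) -> C 3 q_op ->
  idem f -> k_meeting i.-1 f -> C n f.
Proof.
move=> i3 Cd Cq fi; apply: (@d_generates (fun _ _ => True)) i3 Cd fi I => // g gi _.
exact: q_generates.
Qed.

Lemma and_generates n (f : op n) : C 2 and_op -> idem f -> meet_morph f -> C n f.
Proof.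
move=> C_and [f0 f1] fM.
(* The meet of all true points is itself true, hence the least true point; [f] is the meet of the
   variables in its support. *)
pose a : bvec n := [ffun i => all (fun x : bvec n => x i) (enum [pred x | f x])].
have fa : f a.
  have : all f (enum [pred x | f x]) by apply/allP=> x; rewrite mem_enum.
  rewrite /a; elim: (enum [pred x | f x]) => [_|x s IHs /= /andP[fx fs]].
    by apply: etrans f1; congr (f _); apply/ffunP=> i; rewrite !ffunE.
  have -> : [ffun i => x i && all (fun y : bvec n => y i) s] =
      meet x [ffun i => all (fun y : bvec n => y i) s].
    by apply/ffunP=> i; rewrite !ffunE.
  by rewrite fM fx IHs.
suff Ca : term C (fun x => [forall (i | a i), x i]).
  apply: mem_term Ca _ => x; apply/forall_inP/idP => [ax | fx i].
    have ax' : meet a x = a by apply/ffunP=> i; rewrite ffunE; apply/andb_idr/ax.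
    by have := fM a x; rewrite ax' fa.
  by rewrite ffunE => /allP/(_ x); rewrite mem_enum; apply.
apply: (term_forall C_and) => [|i _]; last exact: term_proj.
by case: (cst_or_true a) => // a0; rewrite a0 f0 in fa.
Qed.

Lemma add_disjoint_sum n (f : op n) : idem f -> add_disjoint f ->
  forall x, f x = \big[addb/false]_i (x i && f (unit_bvec i)).
Proof.
move=> fi fA x.
(* Restricting [x] to a list of coordinates allows an induction that peels off one coordinate at a
   time. *)
suff {1}-> : x = [ffun j => (j \in index_enum 'I_n) && x j].
  elim: (index_enum _) (index_enum_uniq 'I_n) => [_|i s IHs /= /andP[si /IHs sE]].
    by rewrite big_nil -(proj1 fi); congr (f _); apply/ffunP=> j; rewrite !ffunE.
  rewrite big_cons -sE; case Ei: (x i) => /=.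
    rewrite -fA; last first.
      by move=> j; rewrite !ffunE; case: eqP => //= ->; rewrite (negbTE si).
    congr (f _); apply/ffunP=> j; rewrite !ffunE inE.
    by case: eqP => //= ->; rewrite Ei (negbTE si).
  by congr (f _); apply/ffunP=> j; rewrite !ffunE inE; case: eqP => //= ->; rewrite Ei andbF.
by apply/ffunP=> j; rewrite ffunE mem_index_enum.
Qed.

(** [f] is a sum of distinct variables, an odd number of them because [f] is true at the all-true
    vector; [m_op] builds odd sums two summands at a time. *)
Lemma m_generates n (f : op n) : C 3 m_op -> idem f -> add_disjoint f -> C n f.
Proof.
move=> Cm fi fA; have fE := add_disjoint_sum fi fA.
pose s := [seq i <- index_enum 'I_n | f (unit_bvec i)].
suff Cs : term C (fun x => \big[addb/false]_(i <- s) x i).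
  apply: mem_term Cs _ => x; rewrite fE big_filter big_mkcond.
  by apply: eq_bigr => i _; rewrite andbC; case: ifP.
have : odd (size s).
  apply: (etrans _ (proj2 fi)); rewrite fE size_filter.
  elim: (index_enum _) => [|i r IHr]; first by rewrite big_nil.
  by rewrite big_cons /= oddD IHr ffunE /=; case: (f _).
have [m] := ubnP (size s); elim: m s => // m IHm [|i [|j s]] //=.
  by move=> _ _; apply: term_ext (term_proj C i) _ => x; rewrite big_seq1.
rewrite ltnS negbK => /ltnW sm s_odd.
apply: term_ext (term3 Cm (term_proj C i) (term_proj C j) (IHm s sm s_odd)) _ => x.
by rewrite !big_cons addbA.
Qed.

(** By Baker-Pixley two points suffice. Negating the false ones makes both true, and then they share
    a coordinate, whose projection interpolates. *)
Lemma mono_selfdual_generates n (f : op n) : C 3 (d_op 3) ->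
  idem f -> mono f -> selfdual f -> C n f.
Proof.
move=> Cd fi fm fs; apply: (nu_interpolation _ Cd) => // X.
pose Y j := if f (X j) then X j else neg (X j).
have fY j : f (Y j) by rewrite /Y; case Ef: (f (X j)); rewrite ?fs Ef.
have [i /andP[Y0 Y1]] := mono_selfdual_meeting fm fs
  (fY (@Ordinal 2 0 isT)) (fY (@Ordinal 2 1 isT)).
exists (proj i) => [|j]; first exact: clone_proj.
have {Y0 Y1}: Y j i by move: j Y0 Y1; apply: ord2_all.
by rewrite /Y !ffunE; case: ifP => // _; rewrite ffunE => /negbTE.
Qed.

(** Again two true points suffice. If they are disjoint, the sum of three variables interpolates:
    one from each support and one outside both. *)
Lemma selfdual_generates n (f : op n) : C 3 (d_op 3) -> C 3 m_op ->
  idem f -> selfdual f -> C n f.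
Proof.
move=> Cd Cm fi fs; apply: (nu_interpolation _ Cd) => // X.
pose Y j := if f (X j) then X j else neg (X j).
have fY j : f (Y j) by rewrite /Y; case Ef: (f (X j)); rewrite ?fs Ef.
suff [g [Cg gs gY]] : exists g : op n, [/\ C n g, selfdual g & forall j, g (Y j)].
  exists g => // j; have := gY j; rewrite /Y; case: ifP => [_ -> //|_].
  by rewrite gs => /negbTE.
pose x := Y (@Ordinal 2 0 isT); pose y := Y (@Ordinal 2 1 isT).
have [fx fy] : f x /\ f y by split; apply: fY.
suff [g [Cg gs gx gy]] : exists g : op n, [/\ C n g, selfdual g, g x & g y].
  by exists g; split=> //; apply: ord2_all.
case: (pickP (fun i => x i && y i)) => [i /andP[xi yi] | xy].
  exists (proj i); split; rewrite ?ffunE //; first exact: clone_proj.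
  by move=> z; rewrite !ffunE.
(* Otherwise [y] is the negation of [x], where the self-dual [f] is false. *)
have [i /andP[xi yi]] : exists i, ~~ x i && ~~ y i.
  case: (pickP (fun i => ~~ x i && ~~ y i)) => [i xyi|nxy]; first by exists i.
  have yE : y = neg x.
    by apply/ffunP=> i; have := nxy i; have := xy i; rewrite ffunE; case: (x i) (y i) => [] [].
  by rewrite yE fs fx in fy.
have ntriv z : f z -> exists j, z j.
  by move=> fz; case: (cst_or_true z) => // z0; rewrite z0 (proj1 fi) in fz.
have [[j xj] [l yl]] := (ntriv x fx, ntriv y fy).
have yj : y j = false by have := xy j; rewrite xj.
have xl : x l = false by have := xy l; rewrite yl andbT.
exists [ffun z : bvec n => z i (+) z j (+) z l]; split.
- by apply: term3 Cm _ _ _; apply: term_proj.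
- by move=> z; rewrite !ffunE; case: (z i) (z j) (z l) => [] [] [].
- by rewrite ffunE xj xl (negbTE xi).
- by rewrite ffunE yj yl (negbTE yi).
Qed.

(** Since [f] vanishes at zero, it is the join over [i] of its meets with the projections, each of
    which lies below a projection. *)
Lemma idem_generates n (f : op n) : C 2 or_op -> C 3 q_op -> idem f -> C n f.
Proof.
move=> C_or Cq fi.
have Cif i : term C (fun x : bvec n => x i && f x).
  apply: (q_generates Cq) => /=; last by exists i => x; rewrite ffunE => /andP[].
  by case: fi => f0 f1; split; rewrite !ffunE ?f0 ?f1.
suff Cs : term C (fun x => has (fun i => x i && f x) (enum 'I_n)).
  apply: mem_term Cs _ => x; apply/hasP/idP => [[i _ /andP[]] // | fx].
  case: (cst_or_true x) => [x0 | [i xi]]; first by rewrite x0 (proj1 fi) in fx.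
  by exists i; rewrite ?mem_enum ?xi.
have : enum 'I_n != [::] by rewrite -size_eq0 size_enum_ord -lt0n (idem_arity fi).
elim: (enum 'I_n) => // i [|j s] IHs _.
  by apply: term_ext (Cif i) _ => x /=; rewrite orbF.
by apply: term_ext (term2 C_or (Cif i) (IHs _)) _.
Qed.

Lemma mq_generates n (f : op n) : C 3 m_op -> C 3 q_op -> idem f -> C n f.
Proof.
move=> Cm Cq; apply: idem_generates => //; apply: mem_op2 => k F G CF CG.
apply: term_ext (term3 Cm CF CG (term_and (and_of_q Cq) CF CG)) _ => x.
by case: (F x) (G x) => [] [].
Qed.

End Generation.

(** * Idempotent self-dual clones *)

Notation gen e := (clone_gen (node_gens e)).

Ltac gen_mem_tac := by apply: gen_base; rewrite // ?inE eqxx ?orbT.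

Lemma generated_sub F (P : forall n, op n -> Prop) :
  (forall n (i : 'I_n), P n (proj i)) ->
  (forall n k (f : op n) (g : 'I_n -> op k),
     P n f -> (forall i, P k (g i)) -> P k (Defs.comp f g)) ->
  (forall t, t \in F -> P (tag t) (tagged t)) ->
  forall n (f : op n), generated F f -> P n f.
Proof.
by move=> Pproj Pcomp PF n f; elim=> {n f} [n f _ /PF // | // | n k f g _ Pf _];
  apply: Pcomp.
Qed.

Lemma generated_min F (C : clone) : (forall t, t \in F -> C (tag t) (tagged t)) ->
  forall n (f : op n), generated F f -> C n f.
Proof. by apply: generated_sub; [apply: clone_proj | apply: clone_comp]. Qed.

Lemma minor_le_sub (A B : clone) : (forall n (f : op n), A n f -> B n f) -> minor_le A B.
Proof. by move=> AB; exists (fun n f => f). Qed.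

Lemma minor_le_gen e (C : clone) :
  (forall t, t \in node_gens e -> C (tag t) (tagged t)) -> minor_le (gen e) C.
Proof. by move=> eC; apply/minor_le_sub/generated_min. Qed.

Lemma cls_node (C : clone) e : (forall t, t \in node_gens e -> C (tag t) (tagged t)) ->
  (forall n (f : op n), C n f -> gen e n f) -> cls C = node_cls e.
Proof. by move=> eC Ce; apply/cls_eqP; split; [apply: minor_le_sub | apply: minor_le_gen]. Qed.

Lemma mem_op3_eq (C : clone) t u : C 3 (op3 t) -> (forall a b c, t a b c = u a b c) ->
  C 3 (op3 u).
Proof. by move=> Ct tu; have <- : t = u by do 3!apply: funext => ?. Qed.

Lemma op3_pick t a b c : op3 t [ffun i => pick3 a b c i] = t a b c.
Proof. by rewrite !ffunE. Qed.

(** The minor that identifies variables along three blocks: the support of [x], the rest of the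
    support of [y], and the remainder. *)
Definition tern n (f : op n) (x y : bvec n) (a b c : bool) :=
  f [ffun i => if x i then a else if y i then b else c].

Lemma mem_tern (C : clone) n (f : op n) x y : C n f -> C 3 (op3 (tern f x y)).
Proof.
move=> Cf; apply: mem_op3 => k F G H CF CG CH.
have CI i : term C (if x i then F else if y i then G else H).
  by case: (x i); last case: (y i).
apply: term_ext (term_app Cf CI) _ => z; rewrite /tern; congr (f _).
by apply/ffunP=> i; rewrite !ffunE; case: (x i); last case: (y i).
Qed.

Lemma tern100 n (f : op n) x y : tern f x y true false false = f x.
Proof. by congr (f _); apply/ffunP=> i; rewrite ffunE; case: (x i) (y i) => [] []. Qed.

Lemma tern010 n (f : op n) (x y : bvec n) :
  (forall i, ~~ (x i && y i)) -> tern f x y false true false = f y.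
Proof.
move=> xy; congr (f _); apply/ffunP=> i; rewrite ffunE.
by have := xy i; case: (x i) (y i) => [] [].
Qed.

Section SelfDual.
Variable C : clone.
Hypothesis C_idem : forall n (f : op n), C n f -> idem f.

(** Identifying variables along the support of [x] yields an idempotent binary operation: a meet, a
    join or a projection. Only a projection is allowed, and then [f] differs at [x] and [neg x]. *)
Lemma selfdual_of_no_and_or n (f : op n) :
  ~ C 2 and_op -> ~ C 2 or_op -> C n f -> selfdual f.
Proof.
move=> C_and C_or Cf x.
have fE a b : f [ffun i => if x i then a else b] =
    if a then b || f x else b && f (neg x).
  have [f0 f1] := C_idem Cf; case: a b => [] [] /=.
  - by rewrite -[RHS]f1; congr (f _); apply/ffunP=> i; rewrite !ffunE; case: ifP.
  - by congr (f _); apply/ffunP=> i; rewrite !ffunE; case: (x i).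
  - by congr (f _); apply/ffunP=> i; rewrite !ffunE; case: (x i).
  - by rewrite -[RHS]f0; congr (f _); apply/ffunP=> i; rewrite !ffunE; case: ifP.
have CfE k (F G : bvec k -> bool) : term C F -> term C G ->
    term C (fun z => if F z then G z || f x else G z && f (neg x)).
  move=> CF CG; have CI i : term C (if x i then F else G) by case: (x i).
  apply: term_ext (term_app Cf CI) _ => z; rewrite -fE; congr (f _).
  by apply/ffunP=> i; rewrite !ffunE; case: (x i).
case Ex: (f x) CfE; case En: (f (neg x)) => //= CfE.
- case: C_or; apply: mem_op2 => k F G CF CG.
  by apply: term_ext (CfE _ _ _ CF CG) _ => z; case: (F z) (G z) => [] [].
- case: C_and; apply: mem_op2 => k F G CF CG.
  by apply: term_ext (CfE _ _ _ CF CG) _ => z; case: (F z) (G z) => [] [].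
Qed.

Hypothesis C_sd : forall n (f : op n), C n f -> selfdual f.

Lemma op3_selfdual t : C 3 (op3 t) ->
  t false false false = false /\ forall a b c, t (~~ a) (~~ b) (~~ c) = ~~ t a b c.
Proof.
move=> Ct; split=> [|a b c].
  by have := proj1 (C_idem Ct); rewrite !ffunE.
rewrite -!(op3_pick t) -(C_sd Ct); congr (op3 t _).
by apply/ffunP; apply: ord3_all; rewrite !ffunE.
Qed.

(** Two of three Booleans agree, so idempotence and self-duality determine [t] from its values at
    the unit vectors. *)
Lemma op3_selfdualE t : C 3 (op3 t) -> forall a b c, t a b c =
  if b == c then a (+) ((a != b) && ~~ t true false false) else
  if a == c then b (+) ~~ t false true false else c (+) ~~ t false false true.
Proof.
move=> /op3_selfdual[t0 tN] a b c.
have [t1 t2] := (tN false false false, tN false false true).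
have [t3 t4] := (tN false true false, tN true false false).
by case: a b c => [] [] []; rewrite /= ?t0 ?(t1, t2, t3, t4) ?t0 //=; case: (t _ _ _).
Qed.

(** Such a [t] is the majority of [a], [b] and the negation of [c]. *)
Lemma op3_two_true t : C 3 (op3 t) ->
  t true false false -> t false true false -> t false false true = false ->
  C 3 (d_op 3) /\ C 3 m_op.
Proof.
move=> Ct tx ty tz; have tE := op3_selfdualE Ct; rewrite tx ty tz /= in tE.
have Cd : C 3 (op3 maj).
  apply: mem_op3 => k F G H CF CG CH.
  apply: term_ext (term3 Ct CF CG (term3 Ct CF CG CH)) _ => z.
  by rewrite !tE; case: (F z) (G z) (H z) => [] [] [].
split; first by rewrite d3E.
apply: mem_op3 => k F G H CF CG CH.
apply: term_ext (term3 Cd (term3 Ct CF CG CH) (term3 Ct CG CH CF) (term3 Ct CH CF CG)) _.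
by move=> z; rewrite !tE; case: (F z) (G z) (H z) => [] [] [].
Qed.

Lemma op3_sides t : C 3 (op3 t) -> t true false false -> t false false true -> C 3 m_op.
Proof.
move=> Ct tx tz; case ty: (t false true false).
  by apply: (mem_op3_eq Ct) => a b c; rewrite (op3_selfdualE Ct) tx ty tz;
    case: a b c => [] [] [].
have Ct' : C 3 (op3 (fun a b c => t a c b)).
  by apply: mem_op3 => k F G H CF CG CH; apply: term3.
by have [] := op3_two_true Ct' tx tz ty.
Qed.

(** With exactly two true unit values [t] yields majority, and with none it is majority. *)
Lemma op3_parity t : ~ C 3 (d_op 3) -> C 3 (op3 t) ->
  t true false false (+) t false true false (+) t false false true.
Proof.
move=> nCd Ct.
have Ct' : C 3 (op3 (fun a b c => t a c b)).
  by apply: mem_op3 => k F G H CF CG CH; apply: term3.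
have Ct'' : C 3 (op3 (fun a b c => t c b a)).
  by apply: mem_op3 => k F G H CF CG CH; apply: term3.
case tx: (t true false false); case ty: (t false true false);
  case tz: (t false false true) => //; case: nCd.
- by have [] := op3_two_true Ct tx ty tz.
- by have [] := op3_two_true Ct' tx tz ty.
- by have [] := op3_two_true Ct'' tz ty tx.
- rewrite d3E; apply: (mem_op3_eq Ct) => a b c.
  by rewrite (op3_selfdualE Ct) tx ty tz; case: a b c => [] [] [].
Qed.

Lemma add_disjoint_of_no_d3 n (f : op n) : ~ C 3 (d_op 3) -> C n f -> add_disjoint f.
Proof.
move=> nCd Cf x y xy; have Ct := mem_tern x y Cf.
have [_ tN] := op3_selfdual Ct.
(* By self-duality the third unit value is the negation of [f] at the sum of [x] and [y], so odd
   parity is additivity. *)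
have := op3_parity nCd Ct; rewrite tern100 tern010 // -[tern _ _ _ _ _ _]negbK -tN /=.
have -> : tern f x y true true false = f [ffun i => x i (+) y i].
  by congr (f _); apply/ffunP=> i; rewrite !ffunE; have := xy i; case: (x i) (y i) => [] [].
by case: (f _) (f _) (f _) => [] [] [].
Qed.

(** If [x] lies below [y] with [f] true at [x] and false at [y], then [f] is true at [x] and at
    [neg y], which are the outer blocks of [tern f x y]. *)
Lemma mono_of_no_m n (f : op n) : ~ C 3 m_op -> C n f -> mono f.
Proof.
move=> nCm Cf x y xy fx; apply: contrapT => /negP nfy; apply: nCm.
have Ct := mem_tern x y Cf; have [_ tN] := op3_selfdual Ct.
apply: op3_sides Ct _ _; rewrite ?tern100 // -[tern _ _ _ _ _ _]negbK -tN /=.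
suff -> : tern f x y true true false = f y by [].
by congr (f _); apply/ffunP=> i; rewrite !ffunE; have := xy i; case: (x i) (y i) => [] [] // ->.
Qed.

(** [f] is a sum of variables. There is at least one summand by idempotence, and two would yield
    [m_op]. *)
Lemma proj_of_no_d3_m n (f : op n) : ~ C 3 (d_op 3) -> ~ C 3 m_op -> C n f ->
  exists i, f = proj i.
Proof.
move=> nCd nCm Cf; have [fi fA] := (C_idem Cf, add_disjoint_of_no_d3 nCd Cf).
have fE := add_disjoint_sum fi fA.
have unit_inj (i j : 'I_n) : f (unit_bvec i) -> f (unit_bvec j) -> i = j.
  move=> fui fuj; apply: contra_not_eq nCm => ij.
  have Ct := mem_tern (unit_bvec i) (unit_bvec j) Cf.
  have uij l : ~~ (unit_bvec i l && unit_bvec j l).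
    by rewrite !ffunE; case: eqP => //= ->.
  have := op3_parity nCd Ct; rewrite tern100 tern010 // fui fuj /=.
  by apply: op3_sides Ct _; rewrite tern100.
case: (pickP (fun i => f (unit_bvec i))) => [i fui | f0]; last first.
  have := proj2 fi; rewrite fE big1 // => i _.
  by rewrite f0 andbF.
exists i; apply/ffunP=> x; rewrite ffunE fE (bigD1 i) //= fui andbT big1 ?addbF // => j ji.
case fuj: (f _); last by rewrite andbF.
by rewrite (unit_inj _ _ fuj fui) eqxx in ji.
Qed.

Lemma selfdual_class : exists e, cls C = node_cls e.
Proof.
have [Cd | nCd] := pselect (C 3 (d_op 3)); have [Cm | nCm] := pselect (C 3 m_op).
- exists N_d3m; apply: cls_node => [t | n f Cf].
    by rewrite !inE => /orP[] /eqP ->.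
  by apply: selfdual_generates (C_idem Cf) (C_sd Cf); gen_mem_tac.
- exists N_d3; apply: cls_node => [t | n f Cf]; first by rewrite !inE => /eqP ->.
  apply: mono_selfdual_generates (C_idem Cf) (mono_of_no_m nCm Cf) (C_sd Cf).
  by gen_mem_tac.
- exists N_m; apply: cls_node => [t | n f Cf]; first by rewrite !inE => /eqP ->.
  apply: m_generates (C_idem Cf) (add_disjoint_of_no_d3 nCd Cf).
  by gen_mem_tac.
- exists N_empty; apply: cls_node => // n f Cf.
  by have [i ->] := proj_of_no_d3_m nCd nCm Cf; apply: clone_proj.
Qed.

End SelfDual.

(** * Clones containing the meet, and the reduction to idempotent clones *)

Definition dual n (f : op n) : op n := [ffun x => ~~ f (neg x)].

Lemma dualK n : involutive (@dual n).
Proof. by move=> f; apply/ffunP=> x; rewrite !ffunE negK negbK. Qed.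

Lemma neg_minor n r (s : 'I_n -> 'I_r) (x : bvec r) :
  neg [ffun i => x (s i)] = [ffun i => neg x (s i)].
Proof. by apply/ffunP=> i; rewrite !ffunE. Qed.

Lemma dual_minor n r (f : op n) (s : 'I_n -> 'I_r) : dual (minor f s) = minor (dual f) s.
Proof. by apply/ffunP=> x; rewrite !ffunE neg_minor. Qed.

Section WithMeet.
Variable C : clone.
Hypothesis C_idem : forall n (f : op n), C n f -> idem f.
Hypothesis C_and : C 2 and_op.

(** A failure of monotonicity gives a ternary minor with values 1, 0, 1 along the chain 100, 110,
    111. Evaluated at the chain [F], [F && G], [F && G && H], it produces [h_op]. *)
Lemma q_of_not_mono n (f : op n) : C n f -> ~ mono f -> C 3 q_op.
Proof.
move=> Cf nfm; suff Ch : C 3 h_op.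
  apply: mem_op3 => k F G H CF CG CH.
  apply: term_ext (term_and C_and (term3 Ch CF CG CH) (term3 Ch CF CH CG)) _ => z.
  by case: (F z) (G z) (H z) => [] [] [].
have [x [y [xy fx fy]]] : exists x y, [/\ le_bvec x y, f x & f y = false].
  apply: contrapT => nxy; apply: nfm => x y xy fx; apply: contrapT => /negP/negbTE fy.
  by apply: nxy; exists x, y.
have Ct := mem_tern x y Cf; have [_ t1] := C_idem Ct.
have t1' : tern f x y true true true by move: t1; rewrite !ffunE.
have t110 : tern f x y true true false = false.
  rewrite -[RHS]fy; congr (f _); apply/ffunP=> i; rewrite ffunE.
  by have := xy i; case: (x i) (y i) => [] [] // ->.
apply: mem_op3 => k F G H CF CG CH.
have CFG := term_and C_and CF CG; have CFGH := term_and C_and CFG CH.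
apply: term_ext (term_and C_and CF (term3 Ct CF CFG CFGH)) _ => z.
by case: (F z) (G z) (H z) => [] [] [] //=; rewrite ?tern100 ?t110 ?t1'.
Qed.

Lemma p_of_not_meet_morph n (f : op n) : C n f -> ~ meet_morph f -> C 3 p_op.
Proof.
move=> Cf nfM; have [fm | /(q_of_not_mono Cf)/p_of_q //] := pselect (mono f).
have [x [y [fx fy fxy]]] : exists x y, [/\ f x, f y & f (meet x y) = false].
  apply: contrapT => nxy; apply: nfM => x y; apply/idP/andP => [fxy | [fx fy]].
    by split; apply: fm fxy => i; rewrite ffunE => /andP[].
  by apply: contrapT => /negP/negbTE fxy; apply: nxy; exists x, y.
(* Blocks: both supports, only [x], only [y], neither. The last receives the meet, so that 110, 101
   and 100 give [f] at [x], [y] and [meet x y]. *)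
pose t a b c := f [ffun i => if x i then (if y i then a else b) else
                             if y i then c else a && b && c].
have Ct k (F G H : bvec k -> bool) : term C F -> term C G -> term C H ->
    term C (fun z => t (F z) (G z) (H z)).
  move=> CF CG CH; have CFGH := term_and C_and (term_and C_and CF CG) CH.
  have CI i : term C (if x i then (if y i then F else G) else
      if y i then H else fun z => F z && G z && H z) by case: (x i) (y i) => [] [].
  apply: term_ext (term_app Cf CI) _ => z; congr (f _); apply/ffunP=> i.
  by rewrite !ffunE; case: (x i) (y i) => [] [].
have t100 : t true false false = false.
  by rewrite -[RHS]fxy; congr (f _); apply/ffunP=> i; rewrite !ffunE; case: (x i) (y i) => [] [].
have t110 : t true true false.
  by move: fx; congr (is_true (f _)); apply/ffunP=> i; rewrite !ffunE; case: (x i) (y i) => [] [].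
have t101 : t true false true.
  by move: fy; congr (is_true (f _)); apply/ffunP=> i; rewrite !ffunE; case: (x i) (y i) => [] [].
have t111 : t true true true.
  by apply: fm fx => i xi; rewrite !ffunE xi; case: (y i).
apply: mem_op3 => k F G H CF CG CH.
apply: term_ext (term_and C_and CF
  (Ct _ _ _ _ CF (term_and C_and CF CG) (term_and C_and CF CH))) _ => z.
by case: (F z) (G z) (H z) => [] [] [].
Qed.

(** Two disjoint true points form blocks of a ternary minor that, with the meet as third argument,
    is the join. *)
Lemma meeting2_of_no_or n (f : op n) : ~ C 2 or_op -> C n f -> k_meeting 2 f.
Proof.
move=> nC_or Cf X fX.
pose x := X (@Ordinal 2 0 isT); pose y := X (@Ordinal 2 1 isT).
case: (pickP (fun i => x i && y i)) => [i /andP[xi yi] | xy].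
  by exists i; apply: ord2_all.
case: nC_or; have Ct := mem_tern x y Cf; have [t0 t1] := C_idem Ct.
have t0' : tern f x y false false false = false by move: t0; rewrite !ffunE.
have t1' : tern f x y true true true by move: t1; rewrite !ffunE.
have t010 : tern f x y false true false.
  by rewrite tern010 => [|i]; [apply: fX | rewrite xy].
have t100 : tern f x y true false false by rewrite tern100; apply: fX.
apply: mem_op2 => k F G CF CG.
apply: term_ext (term3 Ct CF CG (term_and C_and CF CG)) _ => z.
by case: (F z) (G z) => [] [].
Qed.

Lemma d_of_not_meeting k n (f : op n) : (forall n (g : op n), C n g -> k_meeting k g) ->
  C n f -> ~ k_meeting k.+1 f -> C k.+1 (d_op k.+1).
Proof.
move=> Ck Cf nf.
have [X [fX Xi]] : exists X : 'I_k.+1 -> bvec n,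
    (forall j, f (X j)) /\ forall i, exists j, ~~ X j i.
  apply: contrapT => nX; apply: nf => X fX; apply: contrapT => nXi; apply: nX.
  exists X; split=> // i; apply: contrapT => nXj; apply: nXi; exists i => j.
  by apply: contrapT => /negP Xji; apply: nXj; exists j.
(* The meets are nonempty because no coordinate is common to all [X j]. At the vector with a single
   zero [a], the argument of [f] becomes [X a]; so [h] is true there, and it remains to see that two
   zeros make it false. *)
pose h (y : bvec k.+1) := f [ffun i => [forall (j | ~~ X j i), y j]].
have Ch : term C h.
  apply: (term_app Cf) => i; apply: (term_forall C_and) => // j _.
  exact: term_proj.
pose co (a : 'I_k.+1) : bvec k.+1 := [ffun j => j != a].
have hco a : h (co a).
  move: (fX a); congr (is_true (f _)); apply/ffunP=> i; rewrite ffunE.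
  apply/idP/forall_inP => [Xai j Xji | co_a]; last first.
    by apply/negPn/negP=> /co_a; rewrite ffunE eqxx.
  by rewrite ffunE; apply: contraNneq Xji => ->.
have h1 : h (cst _ true).
  suff E : [ffun i => [forall (j | ~~ X j i), cst k.+1 true j]] = cst n true.
    by rewrite /h E; case: (C_idem Cf).
  by apply/ffunP=> i; rewrite !ffunE; apply/forall_inP=> j _; rewrite ffunE.
apply: (mem_term Ch) => y; apply/idP/d_opP => [hy | [a ya]]; last first.
  case Ea: (y a).
    suff -> : y = cst _ true by [].
    by apply/ffunP=> j; rewrite ffunE; have [->//|/ya] := eqVneq j a.
  suff -> : y = co a by [].
  by apply/ffunP=> j; rewrite ffunE; have [->//|/ya] := eqVneq j a.
apply: contrapT => nd; have [y1 | [a ya]] := cst_or_false y.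
  by apply: nd; exists ord0 => j _; rewrite y1 ffunE.
have [b ba yb] : exists2 b, b != a & y b = false.
  apply: contrapT => nb; apply: nd; exists a => b ba; apply: contrapT => /negP/negbTE yb.
  by apply: nb; exists b.
(* These [k] true points of [h] are [y] and all [co c] with [c] different from [a] and [b]. They
   share no coordinate, as [y] vanishes at [a] and [b]. *)
pose Y l := if lift a l == b then y else co (lift a l).
have [l | c Yc] := Ck _ _ Ch Y; first by rewrite ffunE /Y; case: ifP.
have [l Eb] : exists l, b = lift a l.
  by case: (unliftP a b) ba => [l -> _|->]; [exists l | rewrite eqxx].
case: (unliftP a c) Yc => [m -> /(_ m) | -> /(_ l)]; rewrite /Y.
- by case: eqP => [->|_]; rewrite ?yb // ffunE eqxx.
- by rewrite -Eb eqxx ya.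
Qed.

Lemma meet_class_no_or : ~ C 2 or_op -> exists e, cls C = node_cls e.
Proof.
move=> nC_or; have [Cp | nCp] := pselect (C 3 p_op); last first.
  exists N_and; apply: cls_node => [t | n f Cf]; first by rewrite !inE => /eqP ->.
  apply: and_generates (C_idem Cf) _; first by gen_mem_tac.
  by apply: contrapT => /(p_of_not_meet_morph Cf).
have mono_of_no_q n (f : op n) : ~ C 3 q_op -> C n f -> mono f.
  by move=> nCq Cf; apply: contrapT => /(q_of_not_mono Cf).
have [Cb | nCb] := pselect (forall n (f : op n), C n f -> below_proj f).
  have [Cq | nCq] := pselect (C 3 q_op).
    exists N_q; apply: cls_node => [t | n f Cf]; first by rewrite !inE => /eqP ->.
    apply: q_generates (C_idem Cf) (Cb _ _ Cf).
    by gen_mem_tac.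
  exists N_p; apply: cls_node => [t | n f Cf]; first by rewrite !inE => /eqP ->.
  apply: p_generates (C_idem Cf) (mono_of_no_q _ _ nCq Cf) (Cb _ _ Cf).
  by gen_mem_tac.
pose bad k := `[< exists n (f : op n), C n f /\ ~ k_meeting k f >].
have Nbad k : ~~ bad k -> forall n (f : op n), C n f -> k_meeting k f.
  move=> /asboolP nbad n f Cf; apply: contrapT => nf; apply: nbad.
  by exists n, f.
(* The least bad number is a successor [k.+1]: every operation is [k]-meeting, and [k >= 2] as there
   is no join. *)
have /ex_minnP[[|k] /asboolP[n [f [Cf nf]]] kmin] : exists k, bad k.
  apply: contrapT => nbad; apply: nCb => n f Cf; apply: meeting_below_proj.
  by apply: (Nbad _ _ _ _ Cf); apply/negP=> bn; apply: nbad; exists n.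
  by case: nf; apply: k_meeting_le (C_idem Cf) _ (meeting2_of_no_or nC_or Cf).
have k2 : 2 <= k.
  rewrite leqNgt; apply/negP=> k2; apply: nf.
  exact: k_meeting_le (C_idem Cf) k2 (meeting2_of_no_or nC_or Cf).
have Ck : forall n (g : op n), C n g -> k_meeting k g.
  by apply: Nbad; apply/negP=> /kmin; rewrite ltnn.
have Cd := d_of_not_meeting Ck Cf nf.
have [Cq | nCq] := pselect (C 3 q_op).
  exists (@N_dq k.+1 k2); apply: cls_node => [t | l g Cg].
    by rewrite !inE => /orP[] /eqP ->.
  by apply: (@dq_generates _ k.+1 _ _ k2) (C_idem Cg) (Ck _ _ Cg); gen_mem_tac.
exists (@N_dp k.+1 k2); apply: cls_node => [t | l g Cg].
  by rewrite !inE => /orP[] /eqP ->.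
by apply: (@dp_generates _ k.+1 _ _ k2) (C_idem Cg) (mono_of_no_q _ _ nCq Cg) (Ck _ _ Cg);
  gen_mem_tac.
Qed.

(** With [q_op] all idempotent operations are present. Otherwise all operations are monotone; one
    comparison with [N_dp 3] is an inclusion, the other is not. *)
Lemma meet_class_or : C 2 or_op -> exists e, cls C = node_cls e.
Proof.
move=> C_or; have [Cq | nCq] := pselect (C 3 q_op).
  exists N_mq; apply: cls_node => [t | n f Cf]; last first.
    by apply: mq_generates (C_idem Cf); gen_mem_tac.
  rewrite !inE => /orP[] /eqP -> //=; apply: idem_generates => //.
  by split; rewrite !ffunE.
have Cm n (f : op n) : C n f -> mono f.
  by move=> Cf; apply: contrapT => /(q_of_not_mono Cf).
have t_or k (F G : bvec k -> bool) : term C F -> term C G ->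
    term C (fun z => F z || G z) by apply: term2.
exists (@N_dp 3 isT); apply/cls_eqP; split; last first.
  apply: minor_le_gen => t; rewrite !inE => /orP[] /eqP -> /=.
    rewrite d3E; apply: mem_op3 => k F G H CF CG CH.
    by apply: (t_or); [apply: (t_or)|]; apply: term_and.
  by apply: mem_op3 => k F G H CF CG CH; apply: term_and => //; apply: (t_or).
(* [f x && dual f x] is 2-meeting for monotone [f]. *)
exists (fun n (f : op n) => [ffun x => f x && dual f x]); split=> [n f Cf | n r f s _].
  apply: (@dp_generates _ 3); rewrite //; try by gen_mem_tac.
  - have [f0 f1] := C_idem Cf; rewrite /idem !ffunE f0 f1.
    have -> : neg (cst n true) = cst n false by apply/ffunP=> i; rewrite !ffunE.
    by rewrite f0.
  - move=> x y xy; rewrite !ffunE => /andP[/(Cm _ _ Cf _ _ xy) -> /=].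
    apply: contra; apply: (Cm _ _ Cf) => i; rewrite !ffunE.
    by apply: contra; apply: xy.
  - move=> X fX; have [i /andP[X0 X1]] : exists i, X (@Ordinal 2 0 isT) i && X (@Ordinal 2 1 isT) i.
      have := fX (@Ordinal 2 0 isT); have := fX (@Ordinal 2 1 isT).
      rewrite !ffunE => /andP[_ /negbTE f1] /andP[f0 _].
      exact: mono_meeting (Cm _ _ Cf) f0 f1.
    by exists i; apply: ord2_all.
by apply/ffunP=> x; rewrite !ffunE neg_minor.
Qed.

Lemma meet_class : exists e, cls C = node_cls e.
Proof. by have [/meet_class_or | /meet_class_no_or] := pselect (C 2 or_op). Qed.

End WithMeet.

Section DualClone.
Variable C : clone.

Lemma dual_clone_arity n (f : op n) : C n (dual f) -> 0 < n.
Proof. exact: clone_arity. Qed.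

Lemma dual_clone_proj n (i : 'I_n) : C n (dual (proj i)).
Proof.
have -> : dual (proj i) = proj i by apply/ffunP=> x; rewrite !ffunE negbK.
exact: clone_proj.
Qed.

Lemma dual_clone_comp n k (f : op n) (g : 'I_n -> op k) :
  C n (dual f) -> (forall i, C k (dual (g i))) -> C k (dual (Defs.comp f g)).
Proof.
move=> Cf Cg; have -> : dual (Defs.comp f g) = Defs.comp (dual f) (fun i => dual (g i)).
  apply/ffunP=> x; rewrite !ffunE; congr (~~ f _).
  by apply/ffunP=> i; rewrite !ffunE negbK.
exact: clone_comp.
Qed.

Definition dual_clone : clone :=
  @Clone (fun n f => C n (dual f)) dual_clone_arity dual_clone_proj dual_clone_comp.

Lemma cls_dual_clone : cls dual_clone = cls C.
Proof.
apply/cls_eqP; split; exists dual; split=> [n f Cf | n r f s _] //; try exact: dual_minor.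
by rewrite /= dualK.
Qed.

End DualClone.

Lemma idem_dual n (f : op n) : idem (dual f) -> idem f.
Proof.
have negE b : neg (cst n b) = cst n (~~ b) by apply/ffunP=> i; rewrite !ffunE.
by rewrite /idem !ffunE !negE /= => -[/negbFE ? /negbTE ?].
Qed.

Lemma idem_class (C : clone) : (forall n (f : op n), C n f -> idem f) ->
  exists e, cls C = node_cls e.
Proof.
move=> C_idem; have [C_and | nC_and] := pselect (C 2 and_op); first exact: meet_class.
have [C_or | nC_or] := pselect (C 2 or_op).
  rewrite -cls_dual_clone; apply: meet_class => [n f /C_idem /idem_dual // | /=].
  suff -> : dual and_op = or_op by [].
  by apply/ffunP=> x; rewrite /or_op /and_op /op2 !ffunE negb_and !negbK.
by apply: (selfdual_class C_idem) => n f; apply: selfdual_of_no_and_or.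
Qed.

Section IdempotentReduct.
Variable C : clone.

Definition reduct_mem n (f : op n) := C n f /\ idem f.

Lemma reduct_arity n (f : op n) : reduct_mem f -> 0 < n.
Proof. by case=> /clone_arity. Qed.

Lemma reduct_proj n (i : 'I_n) : reduct_mem (proj i).
Proof. by split; [apply: clone_proj | split; rewrite !ffunE]. Qed.

Lemma idem_comp n k (f : op n) (g : 'I_n -> op k) :
  idem f -> (forall i, idem (g i)) -> idem (Defs.comp f g).
Proof.
move=> [f0 f1] gi; split; rewrite ffunE.
- by rewrite -[RHS]f0; congr (f _); apply/ffunP=> i; rewrite !ffunE (proj1 (gi i)).
- by rewrite -[RHS]f1; congr (f _); apply/ffunP=> i; rewrite !ffunE (proj2 (gi i)).
Qed.

Lemma reduct_comp n k (f : op n) (g : 'I_n -> op k) :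
  reduct_mem f -> (forall i, reduct_mem (g i)) -> reduct_mem (Defs.comp f g).
Proof.
move=> [Cf fi] Cg; split; last by apply: idem_comp => // i; case: (Cg i).
by apply: clone_comp => // i; case: (Cg i).
Qed.

Definition reduct : clone := Clone reduct_arity reduct_proj reduct_comp.

(* Without constant operations, the diagonal of [f] is the identity or the
   negation; composing [f] with its diagonal makes [f] idempotent. *)
Lemma cls_reduct : (forall b, ~ C 1 (op1 (fun=> b))) -> cls C = cls reduct.
Proof.
move=> nC; apply/cls_eqP; split; last by apply: minor_le_sub => n f [].
exists (fun n (f : op n) => [ffun x => f (cst n false) (+) f x]); split=> [n f Cf | n r f s Cf].
  have n_gt0 := clone_arity Cf.
  have diag : C 1 (op1 (fun b => f (cst n b))).
    have Cd := term_app Cf (fun i => term_proj C (@Ordinal 1 0 isT)).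
    apply: mem_term Cd _ => x; rewrite ffunE; congr (f _).
  have f01 : f (cst n true) = ~~ f (cst n false).
    case E0: (f (cst n false)); case E1: (f (cst n true)) => //.
    - case: (nC true); have <- // : (fun b => f (cst n b)) = fun=> true.
      by apply: funext => -[].
    - case: (nC false); have <- // : (fun b => f (cst n b)) = fun=> false.
      by apply: funext => -[].
  split; last by split; rewrite !ffunE ?f01; case: (f _).
  have Cf' : term C f by rewrite term_memE.
  rewrite -/(term C _); case E0: (f (cst n false)) in f01 *; last exact: Cf'.
  apply: term_ext (term_app diag (fun=> Cf')) _ => x.
  by rewrite !ffunE; case: (f x); rewrite ?f01 ?E0.
apply/ffunP=> x; rewrite !ffunE; congr (f _ (+) _).
by apply/ffunP=> i; rewrite !ffunE.
Qed.

End IdempotentReduct.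

(** Minors of a constant are constant, so every operation may be sent to the constant of its
    arity. *)
Lemma minor_le_cst (A C : clone) b : C 1 (op1 (fun=> b)) -> minor_le A C.
Proof.
move=> Cb; exists (fun n _ => [ffun=> b]); split=> [n f /clone_arity n_gt0 | n r f s _].
  suff <- : minor (op1 (fun=> b)) (fun=> Ordinal n_gt0) = [ffun=> b] by apply: clone_minor.
  by apply/ffunP=> x; rewrite !ffunE.
by apply/ffunP=> x; rewrite !ffunE.
Qed.

Lemma gen0_zero : gen N_0 1 zero_op.
Proof. by gen_mem_tac. Qed.

Lemma clone_class (C : clone) : exists e, cls C = node_cls e.
Proof.
have [[b Cb] | nCb] := pselect (exists b, C 1 (op1 (fun=> b))).
  exists N_0; apply/cls_eqP; split; first exact: minor_le_cst gen0_zero.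
  exact: minor_le_cst Cb.
rewrite cls_reduct => [|b Cb]; last by apply: nCb; exists b.
by apply: idem_class => n f [].
Qed.

(** * Invariants of the generated clones *)

Lemma idem_proj n (i : 'I_n) : idem (proj i).
Proof. by split; rewrite !ffunE. Qed.

Lemma mono_proj n (i : 'I_n) : mono (proj i).
Proof. by move=> x y xy; rewrite !ffunE; apply: xy. Qed.

Lemma mono_comp n k (f : op n) (g : 'I_n -> op k) :
  mono f -> (forall i, mono (g i)) -> mono (Defs.comp f g).
Proof.
by move=> fm gm x y xy; rewrite !ffunE; apply: fm => i; rewrite !ffunE; apply: gm.
Qed.

Lemma selfdual_proj n (i : 'I_n) : selfdual (proj i).
Proof. by move=> x; rewrite !ffunE. Qed.

Lemma selfdual_comp n k (f : op n) (g : 'I_n -> op k) :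
  selfdual f -> (forall i, selfdual (g i)) -> selfdual (Defs.comp f g).
Proof.
move=> fs gs x; rewrite !ffunE -fs; congr (f _).
by apply/ffunP=> i; rewrite !ffunE gs.
Qed.

Lemma affine_proj n (i : 'I_n) : affine (proj i).
Proof. by move=> x y z; rewrite !ffunE. Qed.

Lemma affine_comp n k (f : op n) (g : 'I_n -> op k) :
  affine f -> (forall i, affine (g i)) -> affine (Defs.comp f g).
Proof.
move=> fa ga x y z; rewrite !ffunE -fa; congr (f _).
by apply/ffunP=> i; rewrite !ffunE ga.
Qed.

Lemma meet_morph_proj n (i : 'I_n) : meet_morph (proj i).
Proof. by move=> x y; rewrite !ffunE. Qed.

Lemma meet_morph_comp n k (f : op n) (g : 'I_n -> op k) :
  meet_morph f -> (forall i, meet_morph (g i)) -> meet_morph (Defs.comp f g).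
Proof.
move=> fM gM x y; rewrite !ffunE -fM; congr (f _).
by apply/ffunP=> i; rewrite !ffunE gM.
Qed.

Lemma k_meeting_proj l n (i : 'I_n) : k_meeting l (proj i).
Proof. by apply: below_proj_meeting; exists i => x; rewrite ffunE. Qed.

Lemma k_meeting_comp l n k (f : op n) (g : 'I_n -> op k) :
  k_meeting l f -> (forall i, k_meeting l (g i)) -> k_meeting l (Defs.comp f g).
Proof.
move=> fk gk X fX.
have [|i gi] := fk (fun j => [ffun i => g i (X j)]).
  by move=> j; have := fX j; rewrite ffunE.
by apply: (gk i X) => j; have := gi j; rewrite ffunE.
Qed.

(** The bound matters: [d_op 1] is constantly true. *)
Lemma d_idem i : 1 < i -> idem (d_op i).
Proof.
case: i => [|[|i]] // _; split; last first.
  by apply/d_opP; exists ord0 => j _; rewrite ffunE.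
apply/negP=> /d_opP[j xj]; have [l lj] : exists l, l != j.
  exists (if j == ord0 then ord_max else ord0).
  by case: (eqVneq j ord0) => [->|] //; rewrite eq_sym.
by have := xj l lj; rewrite ffunE.
Qed.

Lemma d_mono i : mono (d_op i).
Proof.
by move=> x y xy /d_opP[j xj]; apply/d_opP; exists j => l /xj /xy.
Qed.

(** Each true point vanishes at no more than one coordinate, so [i.-1] of them leave one of the [i]
    coordinates untouched. *)
Lemma d_meeting i : 0 < i -> k_meeting i.-1 (d_op i).
Proof.
move=> i_gt0 X dX.
have /fin_all_exists[e eP] (j : 'I_i.-1) : exists a, forall l, l != a -> X j l.
  exact/d_opP/dX.
case: (pickP (fun l => l \notin codom e)) => [l le | e_all].
  by exists l => j; apply: eP; apply: contraNneq le => ->; apply: codom_f.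
have : #|'I_i| <= #|codom e|.
  apply/subset_leq_card/fintype.subsetP=> l _.
  exact: negbFE (e_all l).
rewrite card_ord leqNgt (leq_ltn_trans (card_size _)) //.
by rewrite size_codom card_ord prednK.
Qed.

Lemma maj_selfdual : selfdual (d_op 3).
Proof.
by move=> x; rewrite d3E !ffunE; case: (x _) (x _) (x _) => [] [] [].
Qed.

Lemma q_meeting l : k_meeting l q_op.
Proof.
apply: below_proj_meeting; exists (@Ordinal 3 0 isT) => x.
by rewrite ffunE => /andP[].
Qed.

Lemma p_meeting l : k_meeting l p_op.
Proof.
apply: below_proj_meeting; exists (@Ordinal 3 0 isT) => x.
by rewrite ffunE => /andP[].
Qed.

Lemma p_mono : mono p_op.
Proof.
move=> x y xy; rewrite !ffunE => /andP[/xy -> /=].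
by case/orP=> /xy ->; rewrite ?orbT.
Qed.

Lemma m_idem : idem m_op. Proof. by split; rewrite !ffunE. Qed.
Lemma p_idem : idem p_op. Proof. by split; rewrite !ffunE. Qed.
Lemma q_idem : idem q_op. Proof. by split; rewrite !ffunE. Qed.
Lemma and_idem : idem and_op. Proof. by split; rewrite !ffunE. Qed.

Lemma m_selfdual : selfdual m_op.
Proof. by move=> x; rewrite !ffunE; case: (x _) (x _) (x _) => [] [] []. Qed.

Lemma m_affine : affine m_op.
Proof.
move=> x y z; rewrite !ffunE.
by case: (x _) (x _) (x _) => [] [] []; case: (y _) (y _) (y _) => [] [] [];
  case: (z _) (z _) (z _) => [] [] [].
Qed.

Lemma and_meet_morph : meet_morph and_op.
Proof. by move=> x y; rewrite !ffunE andbACA. Qed.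

Lemma mem_d i e (h : 3 <= i) : e = N_dp h \/ e = N_dq h -> gen e i (d_op i).
Proof.
by case=> ->; apply: gen_base; rewrite ?(leq_trans _ h) // !inE eqxx.
Qed.

Lemma gen_idem e n (f : op n) : e <> N_0 -> gen e n f -> idem f.
Proof.
move=> e0; apply: generated_sub => [||t]; [exact: idem_proj|exact: idem_comp|].
case: e e0 => [| | | | | | |i h|i h| |] //= _; rewrite !inE;
  do ?[case/orP]; move/eqP=> -> /=;
  by [apply: and_idem | apply: m_idem | apply: p_idem | apply: q_idem |
      apply: d_idem; rewrite ?(ltnW h)].
Qed.

Lemma gen_selfdual n (f : op n) : gen N_d3m n f -> selfdual f.
Proof.
apply: generated_sub => [||t]; [exact: selfdual_proj|exact: selfdual_comp|].
rewrite !inE => /orP[] /eqP -> /=; [exact: maj_selfdual | exact: m_selfdual].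
Qed.

Lemma gen_affine n (f : op n) : gen N_m n f -> affine f.
Proof.
apply: generated_sub => [||t]; [exact: affine_proj|exact: affine_comp|].
by rewrite !inE => /eqP ->; apply: m_affine.
Qed.

Lemma gen_meet_morph n (f : op n) : gen N_and n f -> meet_morph f.
Proof.
apply: generated_sub => [||t]; [exact: meet_morph_proj|exact: meet_morph_comp|].
by rewrite !inE => /eqP ->; apply: and_meet_morph.
Qed.

Lemma gen_dp_mono i (h : 3 <= i) n (f : op n) : gen (N_dp h) n f -> mono f.
Proof.
apply: generated_sub => [||t]; [exact: mono_proj|exact: mono_comp|].
by rewrite !inE => /orP[] /eqP -> /=; [apply: d_mono | apply: p_mono].
Qed.

Lemma gen_dp_meeting i (h : 3 <= i) n (f : op n) : gen (N_dp h) n f -> k_meeting i.-1 f.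
Proof.
apply: generated_sub => [n' j|n' k g g'|t]; [exact: k_meeting_proj|exact: k_meeting_comp|].
rewrite !inE => /orP[] /eqP -> /=; last exact: p_meeting.
by apply/d_meeting/(leq_trans _ h).
Qed.

Lemma gen_dq_meeting i (h : 3 <= i) n (f : op n) : gen (N_dq h) n f -> k_meeting i.-1 f.
Proof.
apply: generated_sub => [n' j|n' k g g'|t]; [exact: k_meeting_proj|exact: k_meeting_comp|].
rewrite !inE => /orP[] /eqP -> /=; last exact: q_meeting.
by apply/d_meeting/(leq_trans _ h).
Qed.

Lemma dp_le_dp i (h' : 3 <= i.+1) (h : 3 <= i) : minor_le (gen (N_dp h')) (gen (N_dp h)).
Proof.
apply: minor_le_gen => t; rewrite !inE => /orP[] /eqP -> /=; last gen_mem_tac.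
have d_i := d_idem (ltnW h').
apply: (@dp_generates _ i _ _ h (mem_d (or_introl erefl)) _ d_i (@d_mono _)).
  gen_mem_tac.
exact: k_meeting_le d_i (leq_pred i) (d_meeting (ltn0Sn i)).
Qed.

Lemma dq_le_dq i (h' : 3 <= i.+1) (h : 3 <= i) : minor_le (gen (N_dq h')) (gen (N_dq h)).
Proof.
apply: minor_le_gen => t; rewrite !inE => /orP[] /eqP -> /=; last gen_mem_tac.
have d_i := d_idem (ltnW h').
apply: (@dq_generates _ i _ _ h (mem_d (or_intror erefl)) _ d_i).
  gen_mem_tac.
exact: k_meeting_le d_i (leq_pred i) (d_meeting (ltn0Sn i)).
Qed.

(** Every relation is an inclusion of clones, except the one into [N_0], which uses the constant. *)
Lemma cover_minor_le a b : node_cover a b -> minor_le (gen a) (gen b).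
Proof.
case=> {a b} [| | | | | | |h|i h _|i h' h|i h _|i h' h|i h h'| |h|].
all: try exact: dp_le_dp.
all: try exact: dq_le_dq.
all: try by apply: minor_le_cst gen0_zero.
all: apply: minor_le_gen => t; rewrite ?inE //.
- by move/eqP=> ->; gen_mem_tac.
- by move/eqP=> ->; gen_mem_tac.
- by move/eqP=> ->; apply: (@and_of_p (gen N_p)); gen_mem_tac.
- by move/eqP=> ->; apply: (@p_of_q (gen N_q)); gen_mem_tac.
- by move/eqP=> ->; gen_mem_tac.
- by move/eqP=> ->; gen_mem_tac.
- by move/eqP=> ->; gen_mem_tac.
- case/orP=> /eqP ->; first by apply: mem_d; right; congr N_dq; apply: bool_irrelevance.
  by apply: (@p_of_q (gen (N_dq h'))); gen_mem_tac.
- case/orP=> /eqP ->; last gen_mem_tac.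
  by apply: (@mq_generates (gen N_mq)) (d_idem _) => //; gen_mem_tac.
- case/orP=> /eqP ->; last gen_mem_tac.
  by apply: (@mq_generates (gen N_mq)) (d_idem _) => //; gen_mem_tac.
Qed.

(** * Separation by minor identities *)

Definition bin n (f : op n) (s : pred 'I_n) (a b : bool) :=
  f [ffun i => if s i then a else b].

Lemma bin_op2 t a0 a1 a b :
  bin (op2 t) (pick2 a0 a1) a b = t (if a0 then a else b) (if a1 then a else b).
Proof. by rewrite /bin !ffunE. Qed.

Lemma bin_op3 t a0 a1 a2 a b : bin (op3 t) (pick3 a0 a1 a2) a b =
  t (if a0 then a else b) (if a1 then a else b) (if a2 then a else b).
Proof. by rewrite /bin !ffunE. Qed.

Lemma bin_full n (f : op n) : idem f -> bin f predT =2 (fun a _ => a).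
Proof.
by move=> fi a b; rewrite -[RHS](idem_cst a fi).
Qed.

Lemma bin_tf n (f : op n) (s : pred 'I_n) : bin f s true false = f [ffun i => s i].
Proof. by congr (f _); apply/ffunP=> i; rewrite !ffunE; case: (s i). Qed.

(** An identity between binary minors of [f] passes to its image. Each separation picks a generator
    of [A] whose identities no operation of [B] can satisfy. *)
Lemma bin_transfer (A B : clone) n (f : op n) : A n f -> minor_le A B ->
  exists2 g, B n g & forall s s', bin f s =2 bin f s' -> bin g s =2 bin g s'.
Proof.
move=> Af [xi [xiB xiM]]; exists (xi n f); first exact: xiB.
move=> s s' ss' a b.
pose c (r : pred 'I_n) i : 'I_2 := if r i then @Ordinal 2 0 isT else @Ordinal 2 1 isT.
have binE (h : op n) r (x : bvec 2) :
    minor h (c r) x = bin h r (x (@Ordinal 2 0 isT)) (x (@Ordinal 2 1 isT)).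
  rewrite ffunE; congr (h _); apply/ffunP=> i; rewrite !ffunE /c.
  by case: (r i).
have E : minor f (c s) = minor f (c s') by apply/ffunP=> x; rewrite !binE.
have := xiM _ _ f (c s) Af; rewrite E xiM // => /ffunP/(_ [ffun i => pick2 a b i]).
by rewrite !binE !ffunE.
Qed.

(** Commutativity contradicts self-duality at the vector 10. *)
Lemma and_not_le_selfdual : ~ minor_le (gen N_and) (gen N_d3m).
Proof.
have Af : gen N_and 2 and_op by gen_mem_tac.
move=> /(bin_transfer Af)[g Bg gE]; have gs := gen_selfdual Bg.
have : bin g (pick2 true false) true false = bin g (pick2 false true) true false.
  by apply: gE => a b; rewrite !bin_op2 andbC.
suff -> : bin g (pick2 false true) true false = ~~ bin g (pick2 true false) true false.
  by case: (bin _ _ _ _).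
rewrite /bin -gs; congr (g _).
by apply/ffunP; apply: ord2_all; rewrite !ffunE.
Qed.

(** The majority identities make the image true at 110, 101 and 011, so an affine image is true at
    their sum 000. *)
Lemma d3_not_le_m : ~ minor_le (gen N_d3) (gen N_m).
Proof.
have Af : gen N_d3 3 (d_op 3) by gen_mem_tac.
move=> /(bin_transfer Af)[g Bg gE]; have gi : idem g by apply: gen_idem Bg.
have gmaj a b c : maj a b c -> g [ffun i => pick3 a b c i].
  move=> abc; rewrite -bin_tf (gE _ predT) ?bin_full // d3E => u v.
  rewrite bin_op3 bin_full -?d3E; last exact: d_idem.
  by case: a b c abc u v => [] [] [] // _ [] [].
have := gen_affine Bg [ffun i => pick3 true true false i]
  [ffun i => pick3 true false true i] [ffun i => pick3 false true true i].
rewrite !gmaj // (_ : add3 _ _ _ = cst 3 false) ?(proj1 gi) //.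
by apply/ffunP; apply: ord3_all; rewrite !ffunE.
Qed.

(** The minority identities make the image true at the disjoint points 100 and 010. *)
Lemma m_not_le_d3q (h : 3 <= 3) : ~ minor_le (gen N_m) (gen (N_dq h)).
Proof.
have Af : gen N_m 3 m_op by gen_mem_tac.
move=> /(bin_transfer Af)[g Bg gE]; have gi : idem g by apply: gen_idem Bg.
have gmin a b c : a (+) b (+) c -> g [ffun i => pick3 a b c i].
  move=> abc; rewrite -bin_tf (gE _ predT) ?bin_full // => u v.
  rewrite bin_op3 bin_full; last exact: m_idem.
  by case: a b c abc u v => [] [] [] // _ [] [].
pose X (j : 'I_2) := pick2 [ffun i => pick3 true false false i]
  [ffun i => pick3 false true false i] j.
have [|i Xi] := gen_dq_meeting Bg (X := X).
  by apply: ord2_all; apply: gmin.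
have := Xi (@Ordinal 2 0 isT); have := Xi (@Ordinal 2 1 isT); rewrite !ffunE.
by move: i {Xi}; apply: ord3_all.
Qed.

(** The image is true at 110 and 101, hence at their meet 100; [p(x,y,y) = p(y,x,x)] makes it true
    at 011, hence at 000. *)
Lemma p_not_le_and : ~ minor_le (gen N_p) (gen N_and).
Proof.
have Af : gen N_p 3 p_op by gen_mem_tac.
move=> /(bin_transfer Af)[g Bg gE]; have gi : idem g by apply: gen_idem Bg.
have gM := gen_meet_morph Bg.
have gproj a b : a != b -> g [ffun i => pick3 true a b i].
  move=> ab; rewrite -bin_tf (gE _ predT) ?bin_full // => u v.
  rewrite bin_op3 bin_full; last exact: p_idem.
  by case: a b ab u v => [] [] // _ [] [].
have g100 : g [ffun i => pick3 true false false i].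
  suff -> : [ffun i => pick3 true false false i] =
      meet [ffun i => pick3 true true false i] [ffun i => pick3 true false true i].
    by rewrite gM !gproj.
  by apply/ffunP; apply: ord3_all; rewrite !ffunE.
have g011 : g [ffun i => pick3 false true true i].
  move: g100; rewrite -!bin_tf (gE _ (pick3 false true true)) // => a b.
  by rewrite !bin_op3; case: a b => [] [].
have := gM [ffun i => pick3 true false false i] [ffun i => pick3 false true true i].
rewrite g100 g011 (_ : meet _ _ = cst 3 false) ?(proj1 gi) //.
by apply/ffunP; apply: ord3_all; rewrite !ffunE.
Qed.

(** From [q(x,y,y) = x] the image is true at 100, hence at 110 by monotonicity;
    [q(x,x,y) = q(y,y,x)] moves this to 001, disjoint from 100. *)
Lemma q_not_le_d3p (h : 3 <= 3) : ~ minor_le (gen N_q) (gen (N_dp h)).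
Proof.
have Af : gen N_q 3 q_op by gen_mem_tac.
move=> /(bin_transfer Af)[g Bg gE]; have gi : idem g by apply: gen_idem Bg.
have g100 : g [ffun i => pick3 true false false i].
  rewrite -bin_tf (gE _ predT) ?bin_full // => a b.
  by rewrite bin_op3 bin_full; [case: a b => [] [] | apply: q_idem].
have g110 : g [ffun i => pick3 true true false i].
  by apply: (gen_dp_mono Bg) g100 => j; rewrite !ffunE; move: j; apply: ord3_all.
have g001 : g [ffun i => pick3 false false true i].
  move: g110; rewrite -!bin_tf (gE _ (pick3 false false true)) // => a b.
  by rewrite !bin_op3; case: a b => [] [].
pose X (j : 'I_2) : bvec 3 := pick2 [ffun i => pick3 true false false i]
  [ffun i => pick3 false false true i] j.
have [|i Xi] := gen_dp_meeting Bg (X := X); first by apply: ord2_all.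
have := Xi (@Ordinal 2 0 isT); have := Xi (@Ordinal 2 1 isT); rewrite !ffunE.
by move: i {Xi}; apply: ord3_all.
Qed.

(** The near-unanimity identities make the image true at all [i] vectors with a single zero, which
    share no coordinate; but the image is [i]-meeting. *)
Lemma d_not_le_dq (A : clone) i (h : 3 <= i.+1) : 3 <= i -> A i (d_op i) ->
  ~ minor_le A (gen (N_dq h)).
Proof.
move=> i3 Af /(bin_transfer Af)[g Bg gE]; have gi : idem g by apply: gen_idem Bg.
have [j|l gl] := gen_dq_meeting Bg (X := fun j => [ffun l => l != j]).
  have di := d_idem (ltnW i3).
  rewrite -(bin_tf g (fun l => l != j)) (gE _ predT) ?bin_full // => a b.
  rewrite bin_full // -[RHS](idem_cst a di).
  apply/d_opP/d_opP => -[k dk].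
    have [l /andP[lj lk]] := ord_avoid j k i3.
    by exists k => m _; have := dk l lk; rewrite !ffunE lj.
  exists j => m mj; have [l /andP[_ lk]] := ord_avoid j k i3.
  by have := dk l lk; rewrite !ffunE mj.
by have := gl l; rewrite ffunE eqxx.
Qed.

Lemma zero_not_le_idem : ~ minor_le (gen N_0) (gen N_mq).
Proof.
move=> /(bin_transfer gen0_zero)[g Bg gE]; have gi : idem g by apply: gen_idem Bg.
have E : bin g predT true false = bin g pred0 true false.
  by apply: gE => a b; rewrite /bin !ffunE.
by move: E; rewrite bin_full // bin_tf (proj1 gi).
Qed.

(** * The order and the lattice *)

(** The order in closed form. As indices are at least 3, [i <= 3] means [i = 3]. *)
Definition le_node (a b : node) : bool :=
  match a, b with
  | N_empty, _ | _, N_0 => true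
  | N_0, _ => false
  | _, N_mq => true
  | N_mq, _ => false
  | N_and, (N_and | N_p | N_q | N_dp _ _ | N_dq _ _) => true
  | N_d3, (N_d3 | N_d3m) => true
  | N_d3, (N_dp i _ | N_dq i _) => i <= 3
  | N_m, (N_m | N_d3m) => true
  | N_d3m, N_d3m => true
  | N_p, (N_p | N_q | N_dp _ _ | N_dq _ _) => true
  | N_q, (N_q | N_dq _ _) => true
  | N_dp i _, (N_dp j _ | N_dq j _) => j <= i
  | N_dq i _, N_dq j _ => j <= i
  | _, _ => false
  end.

Definition le_cover := clos_refl_trans node node_cover.

Lemma le_cover_dp i j (h : 3 <= i) (h' : 3 <= j) : j <= i -> le_cover (N_dp h) (N_dp h').
Proof.
move=> /subnK; move: (i - j) => k; elim: k => [|k IHk] in i h *.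
  by move=> ji; subst i; rewrite (bool_irrelevance h h'); apply: rt_refl.
move=> ki; subst i; have h'' : 3 <= k + j by rewrite (leq_trans h') // leq_addl.
by apply: rt_trans (IHk _ h'' erefl); apply: rt_step; apply: cover_dp_dp.
Qed.

Lemma le_cover_dq i j (h : 3 <= i) (h' : 3 <= j) : j <= i -> le_cover (N_dq h) (N_dq h').
Proof.
move=> /subnK; move: (i - j) => k; elim: k => [|k IHk] in i h *.
  by move=> ji; subst i; rewrite (bool_irrelevance h h'); apply: rt_refl.
move=> ki; subst i; have h'' : 3 <= k + j by rewrite (leq_trans h') // leq_addl.
by apply: rt_trans (IHk _ h'' erefl); apply: rt_step; apply: cover_dq_dq.
Qed.

Lemma le_node_cover a b : le_node a b -> le_cover a b.
Proof.
have step x y : node_cover x y -> le_cover x y by apply: rt_step.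
have tr y x z : le_cover x y -> le_cover y z -> le_cover x z by apply: rt_trans.
have refl x : le_cover x x by apply: rt_refl.
have e_and := step _ _ cover_empty_and; have e_d3 := step _ _ cover_empty_d3.
have e_m := step _ _ cover_empty_m; have d3_d3m := step _ _ cover_d3_d3m.
have m_d3m := step _ _ cover_m_d3m; have and_p := step _ _ cover_and_p.
have p_q := step _ _ cover_p_q; have d3m_mq := step _ _ cover_d3m_mq.
have mq_0 := step _ _ cover_mq_0.
have d3_dp (h : 3 <= 3) := step _ _ (cover_d3_d3p h).
have dp_dq i (h : 3 <= i) := step _ _ (cover_dp_dq h h).
(* [cover_p_dp] only reaches indices from 4 on, so the path passes through [i.+1]. *)
have p_dp i (h : 3 <= i) : le_cover N_p (N_dp h).
  by apply: tr (le_cover_dp (leqW h) h (leqnSn i)); apply: (step); apply: cover_p_dp.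
have q_dq i (h : 3 <= i) : le_cover N_q (N_dq h).
  by apply: tr (le_cover_dq (leqW h) h (leqnSn i)); apply: (step); apply: cover_q_dq.
have dq_mq i (h : 3 <= i) : le_cover (N_dq h) N_mq.
  by apply: tr (le_cover_dq h (leqnn 3) h) _; apply: (step); apply: cover_d3q_mq.
have d3_dp' i (h : 3 <= i) : i <= 3 -> le_cover N_d3 (N_dp h).
  by move=> i3; apply: tr (d3_dp (leqnn 3)) (le_cover_dp _ _ _).
have dp_dq' i j (h : 3 <= i) (h' : 3 <= j) : j <= i -> le_cover (N_dp h) (N_dq h').
  by move=> ji; apply: tr (dp_dq _ h) (le_cover_dq _ _ _).
have dp_mq i (h : 3 <= i) := tr _ _ _ (dp_dq _ h) (dq_mq _ h).
have d3_dq i (h : 3 <= i) (i3 : i <= 3) := tr _ _ _ (d3_dp' _ h i3) (dp_dq _ h).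
have e_p := tr _ _ _ e_and and_p; have e_q := tr _ _ _ e_p p_q.
have e_d3m := tr _ _ _ e_m m_d3m; have e_mq := tr _ _ _ e_d3m d3m_mq.
have p_dq i (h : 3 <= i) := tr _ _ _ p_q (q_dq _ h).
have q_mq := tr _ _ _ (q_dq _ (leqnn 3)) (dq_mq _ _).
have to_mq x : le_cover x N_mq -> le_cover x N_0 by move=> xm; apply: tr xm mq_0.
case: a b => [| | | | | | |i h|i h| |] [| | | | | | |j h'|j h'| |] //= le_ij;
  by [exact: le_cover_dp | exact: le_cover_dq | eauto 3 | eauto 6].
Qed.

Lemma minor_le_cover a b : le_cover a b -> minor_le (gen a) (gen b).
Proof.
elim=> {a b} [a b /cover_minor_le // | a | a b c _ ab _ bc].
- exact: minor_le_refl.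
- exact: minor_le_trans ab bc.
Qed.

(** A generating list of non-comparabilities: all others follow by going down on the left and up on
    the right. *)
Inductive separated : node -> node -> Prop :=
| sep_and : separated N_and N_d3m
| sep_d3_m : separated N_d3 N_m
| sep_d3_dq (h : 3 <= 4) : separated N_d3 (N_dq h)
| sep_m (h : 3 <= 3) : separated N_m (N_dq h)
| sep_p : separated N_p N_and
| sep_q (h : 3 <= 3) : separated N_q (N_dp h)
| sep_dp i (h : 3 <= i) (h' : 3 <= i.+1) : separated (N_dp h) (N_dq h')
| sep_0 : separated N_0 N_mq.

Lemma separated_not_le a b : separated a b -> ~ minor_le (gen a) (gen b).
Proof.
case=> [| |h|h| |h|i h h'|].
- exact: and_not_le_selfdual.
- exact: d3_not_le_m.
- by apply: d_not_le_dq => //; gen_mem_tac.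
- exact: m_not_le_d3q.
- exact: p_not_le_and.
- exact: q_not_le_d3p.
- by apply: d_not_le_dq => //; apply: mem_d; left.
- exact: zero_not_le_idem.
Qed.

Lemma not_le_separated a b : ~~ le_node a b ->
  exists u v, [/\ separated u v, le_node u a & le_node b v].
Proof.
have s3 := sep_m (leqnn 3); have s4 := sep_d3_dq (leqnSn 3); have sq := sep_q (leqnn 3).
have s0 := sep_0; have sp := sep_p; have sm := sep_d3_m; have sa := sep_and.
case: a b => [| | | | | | |i h|i h| |] [| | | | | | |j h'|j h'| |] //= ij;
  rewrite -?ltnNge in ij;
  by [exists N_and, N_d3m | exists N_d3, N_m | exists N_d3, (N_dq (leqnSn 3)) |
      exists N_m, (N_dq (leqnn 3)) | exists N_p, N_and | exists N_q, (N_dp (leqnn 3)) |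
      exists N_0, N_mq |
      exists (N_dp h), (N_dq (leqW h)); split; [apply: sep_dp | exact: leqnn | ]].
Qed.

Lemma le_nodeP a b : minor_le (gen a) (gen b) <-> le_node a b.
Proof.
split=> [ab | /le_node_cover/minor_le_cover //]; apply: contrapT => /negP/not_le_separated.
move=> [u [v [/separated_not_le nuv /le_node_cover/minor_le_cover ua]]].
move=> /le_node_cover/minor_le_cover bv; apply: nuv.
exact: minor_le_trans ua (minor_le_trans ab bv).
Qed.

Lemma le_node_cls a b : (node_cls a <= node_cls b)%O = le_node a b.
Proof. by apply/le_clsP/idP => /le_nodeP. Qed.

Lemma le_node_anti a b : le_node a b -> le_node b a -> a = b.
Proof.
case: a b => [| | | | | | |i h|i h| |] [| | | | | | |j h'|j h'| |] //= ji ij.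
- have ? : i = j by [apply/eqP; rewrite eqn_leq ij]; subst j.
  by congr N_dp; apply: bool_irrelevance.
- have ? : i = j by [apply/eqP; rewrite eqn_leq ij]; subst j.
  by congr N_dq; apply: bool_irrelevance.
Qed.

Lemma node_cls_inj : injective node_cls.
Proof. by move=> a b ab; apply: le_node_anti; rewrite -le_node_cls ab. Qed.

(** Only incomparable pairs reach the [match]; thus [N_dp i] meets [N_dq j] there only for [i < j],
    with join [N_dq i]. *)
Definition join_node (a b : node) : node :=
  if le_node a b then b else if le_node b a then a else
  match a, b with
  | N_d3, N_m | N_m, N_d3 => N_d3m
  | N_d3, (N_and | N_p | N_dp _ _) | (N_and | N_p | N_dp _ _), N_d3 => @N_dp 3 isT
  | N_d3, (N_q | N_dq _ _) | (N_q | N_dq _ _), N_d3 => @N_dq 3 isT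
  | (N_q | N_dq _ _), N_dp i h | N_dp i h, (N_q | N_dq _ _) => N_dq h
  | _, _ => N_mq
  end.

Definition meet_node (a b : node) : node :=
  if le_node a b then a else if le_node b a then b else
  match a, b with
  | N_d3m, (N_dp i _ | N_dq i _) | (N_dp i _ | N_dq i _), N_d3m =>
      if i <= 3 then N_d3 else N_empty
  | N_q, N_dp _ _ | N_dp _ _, N_q => N_p
  | N_dp _ _, N_dq j h | N_dq j h, N_dp _ _ => N_dp h
  | _, _ => N_empty
  end.

Lemma le_node_refl a : le_node a a.
Proof. by rewrite -le_node_cls. Qed.

Lemma join_nodeP a b : [/\ le_node a (join_node a b), le_node b (join_node a b) &
  forall c, le_node a c -> le_node b c -> le_node (join_node a b) c].
Proof.
rewrite /join_node; case: ifPn => [ab | nab]; first by split=> //; apply: le_node_refl.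
case: ifPn => [ba | nba]; first by split=> //; apply: le_node_refl.
case: a b nab nba => [| | | | | | |i h|i h| |] [| | | | | | |j h'|j h'| |] //=;
  rewrite -?ltnNge => ij ji; split=> //; try exact: ltnW.
all: by [case=> [| | | | | | |k h''|k h''| |] | rewrite ltnNge ltnW in ij].
Qed.

Lemma meet_nodeP a b : [/\ le_node (meet_node a b) a, le_node (meet_node a b) b &
  forall c, le_node c a -> le_node c b -> le_node c (meet_node a b)].
Proof.
rewrite /meet_node; case: ifPn => [ab | nab]; first by split=> //; apply: le_node_refl.
case: ifPn => [ba | nba]; first by split=> //; apply: le_node_refl.
case: a b nab nba => [| | | | | | |i h|i h| |] [| | | | | | |j h'|j h'| |] //=;
  rewrite -?ltnNge => ij ji; try case: (leqP _ 3) => /= lt3; split=> //; try exact: ltnW.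
all: try (case=> [| | | | | | |k h''|k h''| |] //=;
  by [rewrite leqNgt ij | rewrite leqNgt ji | rewrite leqNgt lt3]).
all: by [case=> [| | | | | | |k h''|k h''| |] | rewrite ltnNge ltnW in ij].
Qed.

Theorem theorem3p22 :
  [/\ (forall e1 e2 : node, node_cls e1 = node_cls e2 -> e1 = e2),
      (forall C : clone, exists! e : node, cls C = node_cls e),
      (forall e1 e2 : node, node_cover e1 e2 -> (node_cls e1 < node_cls e2)%O),
      (forall e1 e2 : node, (node_cls e1 <= node_cls e2)%O <->
         clos_refl_trans node node_cover e1 e2)
    & (forall X Y : PBoole,
         (exists J : PBoole, supremums [set X; Y]%classic J) /\
         (exists M : PBoole, infimums [set X; Y]%classic M))].
Proof.
have node_surj (X : PBoole) : exists e, X = node_cls e.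
  by rewrite -(cls_repr X); apply: clone_class.
split.
- exact: node_cls_inj.
- move=> C; have [e Ce] := clone_class C; exists e; split=> // e' Ce'.
  by apply: node_cls_inj; rewrite -Ce.
- move=> a b ab; rewrite lt_neqAle le_node_cls.
  have -> : le_node a b by apply/le_nodeP/cover_minor_le.
  rewrite andbT; apply/eqP=> /node_cls_inj E.
  (* Only the relations that change an index join nodes of the same shape, and there the indices are
     [i.+1] and [i]. *)
  case: ab E => // i h' h; case=> /esym /n_Sn; exact.
- move=> a b; rewrite le_node_cls; split; first exact: le_node_cover.
  by move=> /minor_le_cover /le_nodeP.
move=> X Y; have [[a ->] [b ->]] := (node_surj X, node_surj Y).
have [aj bj jP] := join_nodeP a b; have [ma mb mP] := meet_nodeP a b.
split; [exists (node_cls (join_node a b)) | exists (node_cls (meet_node a b))].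
- split=> [Z [|] -> | Z Zub]; rewrite ?le_node_cls //.
  have [c Zc] := node_surj Z; rewrite {}Zc in Zub *.
  by rewrite le_node_cls; apply: jP; rewrite -le_node_cls; apply: Zub; [left | right].
- split=> [Z [|] -> | Z Zlb]; rewrite ?le_node_cls //.
  have [c Zc] := node_surj Z; rewrite {}Zc in Zlb *.
  by rewrite le_node_cls; apply: mP; rewrite -le_node_cls; apply: Zlb; [left | right].
Qed.
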